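(* Let $m,n\ge2$ be integers, let $X=\{1,\dots,m\}\times\{1,\dots,n\}$, let $\mathcal P=\{C_1,\dots,C_m\}$ with $C_i=\{i\}\times\{1,\dots,n\}$, and let $S=\langle E(\mathcal T(X,\mathcal P))\rangle$. Then: (i) Every idempotent generating set of $S$ contains a minimal idempotent generating set of $S$. (ii) Every minimal idempotent generating set of $S$ is of the form $U_1^{(1)}\cup\cdots\cup U_m^{(m)}\cup W$, where $U_1,\dots,U_m$ are minimal idempotent generating sets of $\mathcal E_n$ and $$W=\bigcup_{(i,j)\in\Phi_V}\{e_{ij;f}:f\in\mathcal S_n\}\ \cup\bigcup_{(i,j)\in\Xi_V}\Big(\{e_{ij;f}:f\in A_{ij}\}\cup\{e_{ji;f^{-1}}:f\in B_{ij}\}\Big)$$ for some $V\subseteq E(\mathcal D_m)$ with $\mathcal T_m\setminus\mathcal S_m=\langle V\rangle_{\mathrm{sgp}}$ and some choice, for each $(i,j)\in\Xi_V$, of an ordered pair $(A_{ij},B_{ij})$ of non-empty subsets of $\mathcal S_n$ with $\mathcal S_n=A_{ij}\sqcup B_{ij}$ (disjoint union). (iii) The number of minimal idempotent generating sets of $S$ is equal to $$\sigma_n^m\times\sum_{k=0}^{\binom m2}w_{mk}\,(2^{n!}-2)^k,$$ where $\sigma_2=1$ and $\sigma_n=w_n$ otherwise.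
   Context: Maps are written on the right of their arguments and composed from left to right. $\mathcal T_k$ is the monoid of all functions $\{1,\dots,k\}\to\{1,\dots,k\}$, $\mathcal S_k$ is the symmetric group, and $\mathcal E_k$ is the submonoid of $\mathcal T_k$ generated by its idempotents. $E(M)$ denotes the set of idempotents of $M$; $\langle U\rangle$ and $\langle U\rangle_{\mathrm{sgp}}$ denote the submonoid and subsemigroup generated by $U$. An idempotent generating set of a monoid $M$ is a set $U\subseteq E(M)$ with $\langle U\rangle=M$; it is minimal if it has the smallest possible size among idempotent generating sets of $M$. $\mathcal T(X,\mathcal P)$ is the monoid of all functions $f:X\to X$ such that for every $i$ there is a $j$ with $C_if\subseteq C_j$. Each $f\in\mathcal T(X,\mathcal P)$ is uniquely written $f=[f_1,\dots,f_m;\overline f]$ with $\overline f\in\mathcal T_m$ and $f_1,\dots,f_m\in\mathcal T_n$, where $(i,j)f=(i\overline f,jf_i)$; the product is $fg=[f_1g_{1\overline f},\dots,f_mg_{m\overline f};\overline f\,\overline g]$. For $g\in\mathcal T_n$ and $i\in\{1,\dots,m\}$, $g^{(i)}=[1,\dots,1,g,1,\dots,1;1]$ with $g$ in the $i$th position, and $U^{(i)}=\{g^{(i)}:g\in U\}$ for $U\subseteq\mathcal T_n$. $\mathcal D_m=\{f\in\mathcal T_m:|\mathrm{im}(f)|=m-1\}$, and $E(\mathcal D_m)=\{e_{ij}:i,j\in\{1,\dots,m\},\ i\ne j\}$ is the set of idempotents in $\mathcal D_m$, where $e_{ij}$ maps $j$ to $i$ and fixes every other point. For distinct $i,j\in\{1,\dots,m\}$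 and $f\in\mathcal S_n$, $e_{ij;f}=[1,\dots,1,f,1,\dots,1;e_{ij}]$ with $f$ in the $j$th position. For $V\subseteq E(\mathcal D_m)$: $\Xi_V=\{(i,j):1\le i<j\le m,\ e_{ij}\in V\text{ and }e_{ji}\in V\}$ and $\Phi_V=\{(i,j):i,j\in\{1,\dots,m\},\ i\ne j,\ e_{ij}\in V\text{ but }e_{ji}\notin V\}$. $w_n$ is the number of strongly connected tournaments on the (labelled) vertex set $\{1,\dots,n\}$. $w_{mk}$ is the number of strongly connected complete digraphs on the vertex set $\{1,\dots,m\}$ with exactly $k$ double edges. Here digraphs have no loops and at most one edge $u\to v$ for each ordered pair $(u,v)$; a digraph is complete if for all distinct vertices $u,v$ at least one of $u\to v$, $v\to u$ is an edge, and a tournament if exactly one is; a double edge is an unordered pair $\{u,v\}$ with both $u\to v$ and $v\to u$ edges. Recurrences for these numbers: $w_0=1$ and $w_n=F_n-\sum_{s=1}^{n-1}\binom ns w_sF_{n-s}$ for $n\ge1$, where $F_n=2^{\binom n2}$; $w_{00}=1$ and $w_{nk}=F_{nk}-\sum_{s=1}^{n-1}\binom ns\sum_{l=0}^kw_{sl}F_{n-s,k-l}$ for $n\ge1$, where $F_{nk}=\binom{\binom n2}k2^{\binom n2-k}$ (and $w_{sl}=0$ if $l>\binom s2$). *)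

(* Defs.v *)
From HB Require Import structures.
From mathcomp Require Import all_boot all_fingroup.
Set Implicit Arguments.
Unset Strict Implicit.
Unset Printing Implicit Defensive.

Local Open Scope group_scope.

Section FullTransformationMonoid.
Variable T : finType.

(* Maps act on the right: x (f g) = (x f) g, i.e. (f * g) x = g (f x), which
   is also the convention of {perm T}. *)
Definition transf : Type := {ffun T -> T}.
HB.instance Definition _ := Finite.copy transf {ffun T -> T}.

Definition transf_of (f : T -> T) : transf := [ffun x => f x].
Definition transf_app (f : transf) (x : T) : T := (f : {ffun T -> T}) x.
Coercion transf_app : transf >-> Funclass.

Fact transf_ofE (f : T -> T) : transf_of f =1 f.
Proof. exact: ffunE. Qed.
Fact transfP (f g : transf) : f =1 g -> f = g.
Proof. by move=> fg; apply/ffunP. Qed.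

Definition transf_one : transf := transf_of id.
Definition transf_mul (f g : transf) : transf := transf_of (fun x => g (f x)).

Fact transf_mulA : associative transf_mul.
Proof. by move=> f g h; apply: transfP => x; rewrite !transf_ofE. Qed.
Fact transf_mul1 : left_id transf_one transf_mul.
Proof. by move=> f; apply: transfP => x; rewrite !transf_ofE. Qed.
Fact transf_mulr1 : right_id transf_one transf_mul.
Proof. by move=> f; apply: transfP => x; rewrite !transf_ofE. Qed.

HB.instance Definition _ := hasMul.Build transf transf_mul.
HB.instance Definition _ := Magma_isSemigroup.Build transf transf_mulA.
HB.instance Definition _ := hasOne.Build transf transf_one.
HB.instance Definition _ :=
  Magma_isUMagma.Build transf transf_mul1 transf_mulr1.

Fact transf1E (x : T) : (1 : transf) x = x.
Proof. exact: transf_ofE. Qed.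
Fact transfME (f g : transf) (x : T) : (f * g) x = g (f x).
Proof. exact: transf_ofE. Qed.

End FullTransformationMonoid.

Section Generation.
Variable T : finType.
Local Notation M := (transf T).
Implicit Types A B U : {set M}.

Definition idempotents A : {set M} := [set x in A | x * x == x].

Definition mul_closedb A : bool := [forall x in A, forall y in A, x * y \in A].

Definition gen_semigroup U : {set M} :=
  \bigcap_(A : {set M} | (U \subset A) && mul_closedb A) A.

Definition gen_monoid U : {set M} :=
  \bigcap_(A : {set M} | [&& U \subset A, 1 \in A & mul_closedb A]) A.

(* A is meant to be a submonoid of M, with the same identity. *)
Definition idem_gen_set A U : bool :=
  (U \subset idempotents A) && (gen_monoid U == A).

(* Minimality is with respect to cardinality, not inclusion. *)
Definition min_idem_gen_set A U : bool :=
  idem_gen_set A U &&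
    [forall U' : {set M}, idem_gen_set A U' ==> (#|U| <= #|U'|)].

End Generation.

(* The set {1, ..., k} is represented by 'I_k = {0, ..., k - 1}. *)
Section Tk.
Variable k : nat.

Definition sym_group : {set transf 'I_k} :=
  [set transf_of s | s : 'S_k].

Definition idem_gen_part : {set transf 'I_k} :=
  gen_monoid (idempotents [set: transf 'I_k]).

Definition defect1 : {set transf 'I_k} :=
  [set f : transf 'I_k | #|[set f x | x : 'I_k]| == k.-1].

Definition e_map (i j : 'I_k) : transf 'I_k :=
  transf_of (fun x => if x == j then i else x).

Definition Xi (V : {set transf 'I_k}) : {set 'I_k * 'I_k} :=
  [set p : 'I_k * 'I_k |
    [&& p.1 < p.2, e_map p.1 p.2 \in V & e_map p.2 p.1 \in V]].

Definition Phi (V : {set transf 'I_k}) : {set 'I_k * 'I_k} :=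
  [set p : 'I_k * 'I_k |
    [&& p.1 != p.2, e_map p.1 p.2 \in V & e_map p.2 p.1 \notin V]].

End Tk.

Section UniformPartition.
Variables m n : nat.

Definition block (i : 'I_m) : {set 'I_m * 'I_n} := [set (i, j) | j : 'I_n].

Definition T_part : {set transf ('I_m * 'I_n)%type} :=
  [set f : transf ('I_m * 'I_n)%type |
    [forall i, exists j, [set f x | x in block i] \subset block j]].

(* The map [fs 1, ..., fs m; fbar]. *)
Definition wr (fs : 'I_m -> transf 'I_n) (fbar : transf 'I_m) :
    transf ('I_m * 'I_n)%type :=
  transf_of (fun x : 'I_m * 'I_n => (fbar x.1, fs x.1 x.2)).

Definition at_pos (i : 'I_m) (g : transf 'I_n) : transf ('I_m * 'I_n)%type :=
  wr (fun k => if k == i then g else 1) 1.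

Definition e_wr (i j : 'I_m) (f : 'S_n) : transf ('I_m * 'I_n)%type :=
  wr (fun k => if k == j then transf_of f else 1) (e_map i j).

(* Only the values of A and B on Xi V are used. *)
Definition W_set (V : {set transf 'I_m}) (A B : 'I_m -> 'I_m -> {set 'S_n}) :
    {set transf ('I_m * 'I_n)%type} :=
  (\bigcup_(p in Phi V) [set e_wr p.1 p.2 f | f : 'S_n])
  :|: (\bigcup_(p in Xi V)
         ([set e_wr p.1 p.2 f | f in A p.1 p.2]
          :|: [set e_wr p.2 p.1 f^-1 | f in B p.1 p.2])).

End UniformPartition.

(* A loopless digraph on 'I_k is the set G of its edges, an edge u -> v being
   the pair (u, v). *)
Section Digraphs.
Variable k : nat.
Implicit Type G : {set 'I_k * 'I_k}.

Definition loopless G : bool := [forall u, (u, u) \notin G].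

Definition complete_digraph G : bool :=
  loopless G &&
    [forall u, forall v, (u != v) ==> ((u, v) \in G) || ((v, u) \in G)].

Definition tournament G : bool :=
  loopless G &&
    [forall u, forall v, (u != v) ==> ((u, v) \in G) (+) ((v, u) \in G)].

Definition strongly_connected G : bool :=
  [forall u, forall v, connect (fun x y => (x, y) \in G) u v].

Definition double_edges G : {set {set 'I_k}} :=
  [set [set p.1; p.2] | p in G & (p.2, p.1) \in G].

End Digraphs.

Definition w1 (n : nat) : nat :=
  #|[set G : {set 'I_n * 'I_n} | tournament G && strongly_connected G]|.

Definition w2 (m k : nat) : nat :=
  #|[set G : {set 'I_m * 'I_m} |
      [&& complete_digraph G, strongly_connected G & #|double_edges G| == k]]|.

Definition sigma (n : nat) : nat := if n == 2 then 1%N else w1 n.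

(* Main.v *)
Require Import Defs.
From HB Require Import structures.
From mathcomp Require Import all_boot all_fingroup.
Set Implicit Arguments.
Unset Strict Implicit.
Unset Printing Implicit Defensive.

(* An idempotent generating set U of S must contain, for all i, j and f, one of
   the idempotents e_{ij;f} and e_{ji;f^-1}, which have the same kernel: the
   first nontrivial factor u of a product equal to e_{ij;f} satisfies
   ker u <= ker e_{ij;f}.  Following one block
   through such a product shows that the digraph of the available moves between
   blocks is strongly connected, and the elements g^(i) of U must generate a
   copy of E_n for each i.
   Conversely, let these conditions hold and e = e_{ji;f^-1} be in U. A directed
   path of moves gives d in <U> such that d e permutes the image of e, so that
   e (d e)^N = e for some N > 0; then e (d e)^(N-1) d = e_{ij;f}. Hence <U>
   contains all e_{ij;f}, and these together with the g^(i) generate S.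
   The case of blocks of size 1 is Howie's description of the idempotent
   generating sets of E_n by strongly connected complete digraphs. The minimum
   size is reached by selecting one element in each pair, and every strongly
   connected complete digraph on at least three vertices contains a strongly
   connected tournament. *)

Arguments transf_app : simpl never.

(** * Generated submonoids and subsemigroups of a full transformation monoid *)

Section Generation.
Local Open Scope group_scope.
Variable T : finType.
Implicit Types (A U : {set transf T}) (f g e t d : transf T).

(* [transfME] and [transf1E] are stated with the coercion from [finfun], not
   with [transf_app], and cannot be used to rewrite applications. *)
Lemma transf_mulE f g x : transf_app (f * g) x = g (f x).
Proof. exact: transfME. Qed.

Lemma transf_oneE (x : T) : transf_app 1 x = x.
Proof. exact: transf1E. Qed.

Lemma gen_monoid_sub U : U \subset gen_monoid U.
Proof. by apply/bigcapsP => A /and3P[]. Qed.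

Lemma gen_monoid1 U : 1 \in gen_monoid U.
Proof. by apply/bigcapP => A /and3P[]. Qed.

Lemma gen_monoidM U f g :
  f \in gen_monoid U -> g \in gen_monoid U -> f * g \in gen_monoid U.
Proof.
move=> /bigcapP Uf /bigcapP Ug; apply/bigcapP => A UA.
case/and3P: (UA) => _ _ /forall_inP/(_ f (Uf A UA)) /forall_inP.
by apply; apply: Ug.
Qed.

Lemma mem_gen_monoid U f : f \in U -> f \in gen_monoid U.
Proof. by apply/subsetP/gen_monoid_sub. Qed.

(** [gen_monoid] is an intersection of submonoids, while [P] need not be closed under products. The
    elements whose right multiplication preserves [P] on the generated monoid do form a submonoid,
    and it contains [U]. *)
Lemma gen_monoid_ind U (P : pred (transf T)) :
    P 1 -> (forall f u, f \in gen_monoid U -> P f -> u \in U -> P (f * u)) ->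
  forall f, f \in gen_monoid U -> P f.
Proof.
move=> P1 PU f; pose M := gen_monoid U.
pose A := [set g | (g \in M) &&
  [forall h, (h \in M) && P h ==> P (h * g)]].
have AP g : reflect (g \in M /\ forall h, h \in M -> P h -> P (h * g)) (g \in A).
  rewrite inE; apply: (iffP andP) => -[-> H]; split=> //.
    by move=> h Mh Ph; move/forallP/(_ h): H; rewrite Mh Ph.
  by apply/forallP => h; apply/implyP => /andP[]; apply: H.
move/bigcapP/(_ A); case/(_ _)/AP.
  apply/and3P; split.
  - apply/subsetP => u Uu; apply/AP; split; first exact: mem_gen_monoid.
    by move=> h Mh Ph; apply: PU.
  - by apply/AP; split; [apply: gen_monoid1 | move=> h _; rewrite mulg1].
  - apply/forall_inP => x /AP[Mx Hx]; apply/forall_inP => y /AP[My Hy].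
    apply/AP; split; first exact: gen_monoidM.
    by move=> h Mh Ph; rewrite mulgA; apply: Hy; [apply: gen_monoidM|apply: Hx].
by move=> _ /(_ 1 (gen_monoid1 U) P1); rewrite mul1g.
Qed.

Lemma gen_monoid_min U A :
    U \subset A -> 1 \in A -> (forall f g, f \in A -> g \in A -> f * g \in A) ->
  gen_monoid U \subset A.
Proof.
move=> /subsetP UA A1 AM; apply/subsetP.
by apply: gen_monoid_ind => // f u _ Af /UA; apply: AM.
Qed.

Lemma gen_monoidS U A : U \subset gen_monoid A -> gen_monoid U \subset gen_monoid A.
Proof.
by move=> UA; apply: gen_monoid_min => //; [apply: gen_monoid1 | apply: gen_monoidM].
Qed.

(** No product with last factor in [U] is 1, so the generated monoid without 1 is closed under
    multiplication. Conversely, a nonempty product lies in every semigroup containing [U]. *)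
Lemma gen_semigroupE U :
    (forall f g, f \in gen_monoid U -> g \in U -> f * g != 1) ->
  gen_semigroup U = gen_monoid U :\ (1 : transf T).
Proof.
move=> HU; have U1 : 1 \notin U.
  by apply/negP => /(HU 1 1 (gen_monoid1 U)); rewrite mul1g eqxx.
apply/eqP; rewrite eqEsubset; apply/andP; split.
  apply: bigcap_inf; rewrite subsetD1 gen_monoid_sub U1 /=.
  apply/forall_inP => x /setD1P[x1 Ux]; apply/forall_inP => y /setD1P[y1 Uy].
  rewrite in_setD1 gen_monoidM // andbT.
  pose P := [pred y | (y != 1) ==> [forall x in gen_monoid U, x * y != 1]].
  suff: P y by rewrite /P /= y1 => /forall_inP; apply.
  apply: (gen_monoid_ind (P := P)) Uy; first by rewrite /P /= eqxx.
  move=> f u Uf _ Uu; apply/implyP => _; apply/forall_inP => z Uz.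
  by rewrite mulgA HU // gen_monoidM.
apply/subsetP => x /setD1P[x1 Ux]; apply/bigcapP => A /andP[UA /forall_inP AM].
suff: (x == 1) || (x \in A) by rewrite (negPf x1).
move: x Ux {x1}; apply: gen_monoid_ind; first by rewrite eqxx.
move=> f u _ /predU1P[->|Af] /(subsetP UA) Au; first by rewrite mul1g Au orbT.
by apply/orP; right; move/forall_inP: (AM f Af); apply.
Qed.

(** If a product f u is injective then so is f, hence f = 1 by induction, and the injective
    idempotent u is then 1 as well. *)
Lemma gen_idem_inj U f : (forall u, u \in U -> u * u = u) ->
  f \in gen_monoid U -> injective f -> f = 1.
Proof.
move=> Uid Uf /injectiveP; rewrite -[injectiveb f]negbK => fi; apply/eqP.
move: fi; apply: contraNT => f1.
suff: (f == 1) || ~~ injectiveb f by rewrite (negPf f1).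
move: f Uf {f1}; apply: gen_monoid_ind; first by rewrite eqxx.
move=> f u _ IH Uu; rewrite -[_ || _]negbK negb_or negbK.
apply/negP => /andP[fu1 /injectiveP fui].
have fi : injective f.
  by move=> x y xy; apply: fui; rewrite !transf_mulE xy.
have f1 : f = 1 by case/orP: IH => [/eqP//|/injectiveP].
case/negP: fu1; move: fui; rewrite f1 mul1g => ui; apply/eqP.
apply: transfP => x; rewrite transf_oneE; apply: ui.
by rewrite -transf_mulE Uid.
Qed.

(* The kernels of e and t agree (e t = t) and d e permutes the image of e,
   hence e (d e)^N = e for some N > 0, and then t = e (d e)^(N-1) d. *)
Lemma gen_rotate (K : eqType) (pi : T -> K) (i j : K) U e t d :
    e \in gen_monoid U -> d \in gen_monoid U -> e * t = t -> e * e = e ->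
    (forall x, pi x != j -> t x = x) -> (forall x, pi (e x) != i) ->
    {in [pred x | pi x != j] &, injective e} ->
    {in [pred x | pi x != i] &, injective d} ->
    (forall x, pi x != i -> pi (d x) != j) ->
  t \in gen_monoid U.
Proof.
move=> Ue Ud et ee tj ei e_inj d_inj dj.
(* Extended by the identity on the fibre of i, the action of d e becomes a permutation of the whole
   type and has a finite order. *)
pose h x := if pi x == i then x else e (d x).
have h_inj : injective h.
  move=> x y; rewrite /h; case: eqP => [xi|/eqP xi]; case: eqP => [yi|/eqP yi] //.
  - by move=> xe; move: (ei (d y)); rewrite -xe xi eqxx.
  - by move=> ye; move: (ei (d x)); rewrite ye yi eqxx.
  by move/e_inj; rewrite !inE !dj // => /(_ isT isT)/d_inj; apply.
pose s := perm h_inj.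
pose N := #[s].-1.
have hN x : iter N.+1 h x = x.
  rewrite -(eq_iter (permE h_inj)) -permX /N prednK ?order_gt0 //.
  by rewrite expg_order perm1.
pose q k : transf T := iter k (fun w => w * d * e) e.
have Uq k : q k \in gen_monoid U.
  by elim: k => [|k IH] //=; rewrite !gen_monoidM.
have hi k x : pi (iter k h (e x)) != i.
  by elim: k => [|k IH] /=; rewrite ?ei // /h ifN ?ei.
have qE k x : q k x = iter k h (e x).
  by elim: k => //= k IH; rewrite !transf_mulE IH /h ifN.
have -> : t = q N * d; last by rewrite gen_monoidM.
have qdE x : pi (d (q N x)) != j.
  by apply: dj; rewrite qE.
(* The value of [q N * d] at x lies outside the fibre of j, so t fixes it; writing this t as e t
   closes the cycle, since [q N.+1] is e. *)
apply: transfP => x; rewrite transf_mulE -[RHS]tj //.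
rewrite -[in RHS]et [in RHS]transf_mulE.
have -> : e (d (q N x)) = q N.+1 x by rewrite /= !transf_mulE.
by rewrite qE hN -transf_mulE et.
Qed.

End Generation.

Lemma gen_monoid_morph (T1 T2 : finType) (phi : transf T1 -> transf T2)
    (U1 : {set transf T1}) (U2 : {set transf T2}) :
    phi 1%g = 1%g -> {morph phi : x y / (x * y)%g} ->
    (forall u, u \in U1 -> phi u \in gen_monoid U2) ->
  forall f, f \in gen_monoid U1 -> phi f \in gen_monoid U2.
Proof.
move=> phi1 phiM U12.
apply: (gen_monoid_ind (P := fun f => phi f \in gen_monoid U2)).
  by rewrite phi1 gen_monoid1.
by move=> f u _ Uf /U12 Uu; rewrite phiM gen_monoidM.
Qed.

(** * Singular transformations *)

Section Singular.
Local Open Scope group_scope.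
Variable k : nat.
Implicit Types (f g : transf 'I_k) (a b c i j : 'I_k).

Definition emaps : {set transf 'I_k} :=
  [set e_map p.1 p.2 | p : 'I_k * 'I_k & p.1 != p.2].

Lemma e_mapE i j x : e_map i j x = if x == j then i else x.
Proof. exact: transf_ofE. Qed.

Lemma mem_emaps i j : i != j -> e_map i j \in emaps.
Proof. by move=> ij; apply/imsetP; exists (i, j); rewrite ?inE. Qed.

Lemma emapsP f :
  reflect (exists i j, i != j /\ f = e_map i j) (f \in emaps).
Proof.
apply: (iffP imsetP) => [[[i j]]|[i [j [ij ->]]]].
  by rewrite inE /= => ij ->; exists i, j.
by exists (i, j); rewrite ?inE.
Qed.

Lemma e_map_idem i j : e_map i j * e_map i j = e_map i j.
Proof.
apply: transfP => x; rewrite transf_mulE !e_mapE.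
by case: (x =P j) => [_|/eqP/negPf ->]; rewrite ?if_same.
Qed.

Lemma e_map_neq1 i j : i != j -> e_map i j != 1.
Proof.
move=> ij; apply/eqP => /(congr1 (fun f => transf_app f j)).
by rewrite e_mapE eqxx transf_oneE => /eqP; rewrite (negPf ij).
Qed.

Lemma e_map_inj i j i' j' :
  i != j -> e_map i j = e_map i' j' -> i = i' /\ j = j'.
Proof.
move=> ij E; have /(_ j) := fun x => congr1 (fun f => transf_app f x) E.
rewrite !e_mapE eqxx; case: (j =P j') => [<- -> //|_ ij0].
by rewrite ij0 eqxx in ij.
Qed.

Lemma mul_noninj f g : ~~ injectiveb f -> ~~ injectiveb (f * g : transf 'I_k).
Proof.
apply: contra => /injectiveP H; apply/injectiveP => x y xy.
by apply: H; rewrite !transf_mulE xy.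
Qed.

Lemma noninj_hole f : ~~ injectiveb f -> exists c, forall x, f x != c.
Proof.
move=> fN; case: (pickP [pred c | [forall x, f x != c]]) => [c /forallP|H].
  by exists c.
case/negP: fN; apply/injectiveP => x y fxy.
have /image_injP : #|image f 'I_k| == #|'I_k|; last by apply.
apply/eqP/eq_card => c; rewrite [RHS]inE.
by have /negbT/forallPn[z] := H c; rewrite negbK => /eqP <-; apply: image_f.
Qed.

(* A transposition of a and b is a composite of three moves through the free
   point c. *)
Lemma mul_tperm_emaps f a b : ~~ injectiveb f ->
  f \in gen_monoid emaps -> f * transf_of (tperm a b) \in gen_monoid emaps.
Proof.
move=> /noninj_hole[c fc] Uf; have [<-|ab] := eqVneq a b.
  rewrite (_ : f * _ = f) //; apply: transfP => x.
  by rewrite transf_mulE transf_ofE tperm1 perm1.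
(* If the free point is a or b itself, a single move agrees with the transposition on the image of
   f. *)
have [ca|ca] := eqVneq c a.
  rewrite (_ : f * _ = f * e_map a b).
    by rewrite gen_monoidM // mem_gen_monoid // mem_emaps.
  apply: transfP => x; rewrite !transf_mulE transf_ofE e_mapE.
  by move: (fc x); rewrite ca; case: tpermP => [->|->|_ /eqP/negPf->//]; rewrite ?eqxx.
have [cb|cb] := eqVneq c b.
  rewrite (_ : f * _ = f * e_map b a).
    by rewrite gen_monoidM // mem_gen_monoid // mem_emaps // eq_sym.
  apply: transfP => x; rewrite !transf_mulE transf_ofE e_mapE.
  by move: (fc x); rewrite cb; case: tpermP => [->|->|/eqP/negPf->//]; rewrite ?eqxx.
rewrite (_ : f * _ = f * (e_map c a * e_map a b * e_map b c)).
  by rewrite !gen_monoidM // mem_gen_monoid // mem_emaps // eq_sym.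
apply: transfP => x; rewrite !transf_mulE transf_ofE !e_mapE.
case: tpermP => [->|->|/eqP/negPf-> /eqP/negPf fb].
- by rewrite eqxx (negPf cb) eqxx.
- by rewrite [b == a]eq_sym (negPf ab) eqxx [a == c]eq_sym (negPf ca).
- by rewrite fb (negPf (fc x)).
Qed.

Lemma mul_perm_emaps f (s : 'S_k) : ~~ injectiveb f ->
  f \in gen_monoid emaps -> f * transf_of s \in gen_monoid emaps.
Proof.
case: (prod_tpermP s) => ts -> _; elim: ts f => [|t ts IH] f fN Uf.
  rewrite big_nil (_ : f * _ = f) //; apply: transfP => x.
  by rewrite transf_mulE transf_ofE perm1.
rewrite big_cons (_ : f * _ = f * transf_of (tperm t.1 t.2)
    * transf_of (\prod_(t <- ts) tperm t.1 t.2)).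
  by apply: IH; [apply: mul_noninj | apply: mul_tperm_emaps].
by apply: transfP => x; rewrite !transf_mulE !transf_ofE permM.
Qed.

(** Induction on the number of points moved. For c outside the image, f = g e_{yc} with y = f c,
    where g fixes c and otherwise agrees with f, so g moves fewer points. If g is a permutation, it
    is absorbed after one idempotent. *)
Lemma noninj_gen_emaps f : ~~ injectiveb f -> f \in gen_monoid emaps.
Proof.
have [N] := ubnP #|[set x | f x != x]|; elim: N f => // N IH f; rewrite ltnS.
move=> fN fNinj; have [c fc] := noninj_hole fNinj.
pose y := f c; have yc : y != c := fc c.
pose g : transf 'I_k := transf_of (fun x => if x == c then c else f x).
have fE : f = g * e_map y c.
  apply: transfP => x; rewrite transf_mulE e_mapE transf_ofE.
  by case: (x =P c) => [->|_]; rewrite ?eqxx // (negPf (fc x)).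
have [g_inj|gN] := boolP (injectiveb g); last first.
  rewrite fE; apply: gen_monoidM; last by rewrite mem_gen_monoid ?mem_emaps.
  apply: IH => //.
  apply: leq_trans fN; apply: proper_card; apply/properP; split.
    apply/subsetP => x; rewrite !inE transf_ofE.
    by case: (x =P c) => [->|//]; rewrite eqxx.
  by exists c; rewrite !inE //; rewrite transf_ofE eqxx /= eqxx.
pose s := perm (injectiveP _ g_inj); have gE x : g x = s x by rewrite permE.
(* Conjugation by s moves the permutation to the right of the idempotent, where a free point is
   available. *)
rewrite (_ : f = e_map (s^-1 y) (s^-1 c) * transf_of s).
  apply: mul_perm_emaps; last by rewrite mem_gen_monoid // mem_emaps // (inj_eq perm_inj).
  apply/injectiveP => /(_ (s^-1 y) (s^-1 c)); rewrite !e_mapE eqxx if_same.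
  by move=> /(_ erefl)/perm_inj/eqP; rewrite (negPf yc).
apply: transfP => x; rewrite {1}fE !transf_mulE transf_ofE !e_mapE gE.
by rewrite -[x == _](inj_eq (@perm_inj _ s)) permKV; case: ifP; rewrite ?permKV.
Qed.

(** The first idempotent of a factorization is split off because it already frees a block, which
    gives room to permute the contents of the others. *)
Lemma noninj_e_map_left f : ~~ injectiveb f ->
  exists i j h, [/\ i != j, h \in gen_monoid emaps & f = e_map i j * h].
Proof.
move=> fN; have := noninj_gen_emaps fN.
pose P f := (f == 1) || [exists i, exists j, (i != j) &&
  [exists h in gen_monoid emaps, f == e_map i j * h]].
move=> Uf; have : P f.
  apply: (gen_monoid_ind (P := P)) Uf; first by rewrite /P eqxx.
  move=> g u Ug Pg /emapsP[i [j [ij ->]]]; apply/orP; right.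
  case/predU1P: Pg => [->|].
    apply/existsP; exists i; apply/existsP; exists j; rewrite ij /=.
    by apply/exists_inP; exists 1; rewrite ?gen_monoid1 // mul1g mulg1.
  case/existsP=> i' /existsP[j' /andP[ij' /exists_inP[h Uh /eqP->]]].
  apply/existsP; exists i'; apply/existsP; exists j'; rewrite ij' /=.
  apply/exists_inP; exists (h * e_map i j); rewrite ?mulgA //.
  by rewrite gen_monoidM // mem_gen_monoid // mem_emaps.
case/predU1P => [f1|].
  by case/negP: fN; rewrite f1; apply/injectiveP => x y; rewrite !transf_oneE.
case/existsP=> i /existsP[j /andP[ij /exists_inP[h Uh /eqP fE]]].
by exists i, j, h.
Qed.

Lemma idem_gen_part_inj f : f \in idem_gen_part k -> injective f -> f = 1.
Proof. by apply: gen_idem_inj => u; rewrite !inE => /eqP. Qed.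

Lemma gen_monoid_emaps : gen_monoid emaps = idem_gen_part k.
Proof.
apply/eqP; rewrite eqEsubset; apply/andP; split; apply: gen_monoidS.
  apply/subsetP => u /emapsP[i [j [ij ->]]]; apply: mem_gen_monoid.
  by rewrite !inE e_map_idem eqxx.
apply/subsetP => u; rewrite !inE /= => /eqP uu.
have [/injectiveP ui|uN] := boolP (injectiveb u); last exact: noninj_gen_emaps.
rewrite (idem_gen_part_inj _ ui) ?gen_monoid1 //.
by apply: mem_gen_monoid; rewrite !inE uu eqxx.
Qed.

Lemma noninj_idem_gen_part f : ~~ injectiveb f -> f \in idem_gen_part k.
Proof. by rewrite -gen_monoid_emaps; apply: noninj_gen_emaps. Qed.

End Singular.

(** * Transformations preserving a uniform partition *)

Section Wreath.
Local Open Scope group_scope.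
Variables m n' : nat.
Local Notation n := n'.+1.
Local Notation X := ('I_m * 'I_n)%type.
Local Notation S := (gen_monoid (idempotents (T_part m n))).
Implicit Types (p u : transf X) (fs hs : 'I_m -> transf 'I_n).
Implicit Types (g h : transf 'I_m) (U : {set transf X}) (f : 'S_n).
Implicit Types i j k l c : 'I_m.

Lemma wrE fs g (x : X) : wr fs g x = (g x.1, fs x.1 x.2).
Proof. exact: transf_ofE. Qed.

Lemma wrM fs g hs h :
  wr fs g * wr hs h = wr (fun i => fs i * hs (g i)) (g * h).
Proof. by apply: transfP => x; rewrite transf_mulE !wrE /= !transf_mulE. Qed.

Lemma eq_wr fs hs g : fs =1 hs -> wr fs g = wr hs g.
Proof. by move=> E; apply: transfP => x; rewrite !wrE E. Qed.

Lemma wr_inj fs g hs h : wr fs g = wr hs h -> g = h /\ fs =1 hs.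
Proof.
move=> E; have Ex x : wr fs g x = wr hs h x by rewrite E.
split=> [|i]; apply: transfP => x.
  by have := Ex (x, ord0); rewrite !wrE => -[].
by have := Ex (i, x); rewrite !wrE => -[].
Qed.

Lemma wr1 : wr (fun _ => 1) 1 = 1 :> transf X.
Proof. by apply: transfP => -[i x]; rewrite wrE !transf_oneE. Qed.

(** The induced map on blocks, read at a base point of each block; for maps preserving the partition
    the choice of the point is immaterial. *)
Definition tbar p : transf 'I_m := transf_of (fun i => (p (i, ord0)).1).
Definition tcomp p (i : 'I_m) : transf 'I_n := transf_of (fun x => (p (i, x)).2).

Lemma tbar_wr fs g : tbar (wr fs g) = g.
Proof. by apply: transfP => i; rewrite transf_ofE wrE. Qed.

Lemma tcomp_wr fs g i : tcomp (wr fs g) i = fs i.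
Proof. by apply: transfP => x; rewrite transf_ofE wrE. Qed.

Lemma T_part_fst p i x y : p \in T_part m n -> (p (i, x)).1 = (p (i, y)).1.
Proof.
rewrite inE => /forallP/(_ i)/existsP[j /subsetP pj].
have H z : (p (i, z)).1 = j.
  have /pj/imsetP[w _ ->//] : p (i, z) \in [set p x | x in block n i].
  by apply/imset_f/imset_f; rewrite inE.
by rewrite !H.
Qed.

Lemma T_partP p : reflect (exists fs g, p = wr fs g) (p \in T_part m n).
Proof.
apply: (iffP idP) => [pT|[fs [g ->]]].
  exists (tcomp p), (tbar p); apply: transfP => -[i x].
  rewrite wrE !transf_ofE /= -(T_part_fst i x ord0 pT); exact: surjective_pairing.
rewrite inE; apply/forallP => i; apply/existsP; exists (g i).
apply/subsetP => _ /imsetP[_ /imsetP[x _ ->] ->].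
by rewrite wrE; apply: imset_f; rewrite inE.
Qed.

Lemma wr_T_part fs g : wr fs g \in T_part m n.
Proof. by apply/T_partP; exists fs, g. Qed.

(** The block map of an idempotent is idempotent. If a product of block maps is 1, each of them is
    1, and the components, then idempotent, multiply block by block. *)
Lemma gen_T_part_wr fs g : wr fs g \in S ->
  g \in idem_gen_part m /\ (g = 1 -> forall i, fs i \in idem_gen_part n).
Proof.
pose P p := [&& p \in T_part m n, tbar p \in idem_gen_part m
  & (tbar p == 1) ==> [forall i, tcomp p i \in idem_gen_part n]].
suff PP p : p \in S -> P p.
  case/PP/and3P=> _; rewrite tbar_wr => -> /implyP H; split=> // g1 i.
  by move: H; rewrite g1 eqxx => /(_ isT)/forallP/(_ i); rewrite tcomp_wr.
apply: gen_monoid_ind => {p} [|p u _].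
  rewrite /P -wr1 wr_T_part tbar_wr gen_monoid1 /=; apply/implyP => _.
  by apply/forallP => i; rewrite tcomp_wr gen_monoid1.
case/and3P => /T_partP[fs' [g' ->]]; rewrite tbar_wr => g'E H'.
rewrite inE => /andP[/T_partP[us [ub ->]]]; rewrite wrM => /eqP/wr_inj[ubb uss].
rewrite /P wrM wr_T_part tbar_wr.
have ubE : ub \in idem_gen_part m by apply: mem_gen_monoid; rewrite !inE ubb /=.
rewrite gen_monoidM //=; apply/implyP => /eqP gu1.
have g'1 : g' = 1.
  apply: idem_gen_part_inj => // x y xy.
  by rewrite -(transf_oneE x) -(transf_oneE y) -gu1 !transf_mulE xy.
have ub1 : ub = 1 by rewrite -gu1 g'1 mul1g.
apply/forallP => i; rewrite tcomp_wr g'1 transf_oneE.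
apply: gen_monoidM.
  by move: H'; rewrite g'1 eqxx => /forallP/(_ i); rewrite tcomp_wr.
apply: mem_gen_monoid; rewrite !inE /=; have := uss i.
by rewrite ub1 transf_oneE => /eqP.
Qed.

Lemma e_wrE i j f (x : X) : e_wr i j f x = if x.1 == j then (i, f x.2) else x.
Proof.
case: x => k x; rewrite wrE e_mapE /=.
by case: eqP => _; rewrite ?transf_ofE ?transf_oneE.
Qed.

Lemma at_posE i (q : transf 'I_n) (x : X) :
  at_pos i q x = if x.1 == i then (i, q x.2) else x.
Proof.
case: x => k x; rewrite wrE transf_oneE /=.
by case: eqP => [->|_]; rewrite ?transf_oneE.
Qed.

Lemma at_pos1 i : at_pos i 1 = 1 :> transf X.
Proof. by rewrite -wr1; apply: eq_wr => k; rewrite if_same. Qed.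

Lemma at_posM i : {morph @at_pos m n i : q r / q * r}.
Proof.
move=> q r; apply: transfP => -[k x]; rewrite transf_mulE !at_posE /=.
by have [_|ki] := eqVneq k i; rewrite /= ?eqxx ?transf_mulE ?(negPf ki).
Qed.

Lemma at_pos_inj i : injective (@at_pos m n i).
Proof.
by move=> q r /wr_inj[_ /(_ i)]; rewrite eqxx.
Qed.

Lemma e_wr_idem i j f : i != j -> e_wr i j f * e_wr i j f = e_wr i j f.
Proof.
move=> ij; apply: transfP => -[k x]; rewrite transf_mulE !e_wrE /=.
by have [_|kj] := eqVneq k j; rewrite /= ?(negPf ij) ?(negPf kj).
Qed.

Lemma e_wr_S i j f : i != j -> e_wr i j f \in S.
Proof.
move=> ij; apply: mem_gen_monoid; rewrite inE wr_T_part.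
by rewrite /= e_wr_idem.
Qed.

Lemma e_wr_inj i j f i' j' f' : i != j ->
  e_wr i j f = e_wr i' j' f' -> [/\ i = i', j = j' & f = f'].
Proof.
move=> ij E; have [/(e_map_inj ij)[ii jj] _] := wr_inj E.
split=> //; subst i' j'; apply/permP => x.
by move/(congr1 (fun t => transf_app t (j, x))): E; rewrite !e_wrE eqxx => -[].
Qed.

Lemma e_wr_neq1 i j f : i != j -> e_wr i j f != 1.
Proof.
by move=> ij; apply/eqP; rewrite -wr1 => /wr_inj[/eqP]; rewrite (negPf (e_map_neq1 ij)).
Qed.

Lemma at_pos_S i q : q \in idem_gen_part n -> at_pos i q \in S.
Proof.
apply: gen_monoid_morph; [exact: at_pos1 | exact: at_posM |].
move=> u; rewrite !inE /= => /eqP uu; apply: mem_gen_monoid.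
by rewrite inE wr_T_part -at_posM uu /=.
Qed.

Lemma wr_one_gen U fs : (forall i, at_pos i (fs i) \in gen_monoid U) ->
  wr fs 1 \in gen_monoid U.
Proof.
move=> Uat.
suff H (s : seq 'I_m) : uniq s ->
    wr (fun l => if l \in s then fs l else 1) 1 \in gen_monoid U.
  rewrite (eq_wr (hs := fun l => if l \in enum 'I_m then fs l else 1)).
    by rewrite H // enum_uniq.
  by move=> l; rewrite mem_enum.
elim: s => [_|l s IH /= /andP[ls /IH Us]]; first by rewrite wr1 gen_monoid1.
rewrite (_ : wr _ _ =
    at_pos l (fs l) * wr (fun l => if l \in s then fs l else 1) 1).
  by rewrite gen_monoidM.
rewrite wrM mulg1; apply: eq_wr => k; rewrite inE transf_oneE.
by case: (k =P l) => [->|_]; rewrite ?(negPf ls) ?mulg1 ?mul1g.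
Qed.

(* An arc (i, j) records that block j can be moved onto block i, so that the
   free block travels from i to j. *)
Definition arcs U : {set 'I_m * 'I_m} :=
  [set q | (q.1 != q.2) && [exists f, e_wr q.1 q.2 f \in U]].

Definition comps U (i : 'I_m) : {set transf 'I_n} :=
  [set q | at_pos i q \in U].

Definition covers U : Prop :=
  forall i j f, i != j -> (e_wr i j f \in U) || (e_wr j i f^-1 \in U).

(** * Generation from the covering and connectivity conditions *)

Section Sufficiency.
Variable U : {set transf X}.
Hypothesis Ucov : covers U.
Hypothesis Usc : strongly_connected (arcs U).

(** A move e_{ik;f} fills block i from block k: it is injective off block i and leaves block k free.
    Composing the moves of a directed path carries the free block from i to j. *)
Lemma arcs_walk i j : exists2 d : transf X, d \in gen_monoid U &
  {in [pred x : X | x.1 != i] &, injective (d : transf X)}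
  /\ forall x : X, x.1 != i -> (d x).1 != j.
Proof.
have /forallP/(_ i)/forallP/(_ j)/connectP[q] := Usc.
elim: q i => [|k q IH] i /= => [_ ->|/andP[ik qk] jl].
  exists 1; first exact: gen_monoid1.
  by split=> [x y _ _|x]; rewrite !transf_oneE.
have [d Ud [d_inj dj]] := IH k qk jl.
move: ik; rewrite inE => /andP[/= ik /existsP[f Uf]].
have E1 x : x.1 != i -> (e_wr i k f x).1 != k.
  by rewrite e_wrE; case: (x.1 =P k) => [_|/eqP].
exists (e_wr i k f * d); first by rewrite gen_monoidM // mem_gen_monoid.
split=> [x y xi yi|x xi]; rewrite !transf_mulE; last by rewrite dj // E1.
move/d_inj; rewrite !inE !E1 // => /(_ isT isT).
move: xi yi; case: x => a x; case: y => b y; rewrite !inE !e_wrE /=.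
case: (a =P k) => [->|_]; case: (b =P k) => [->|_] // ai bi.
- by case=> /perm_inj->.
- by case=> bi'; rewrite -bi' eqxx in bi.
- by case=> ai'; rewrite ai' eqxx in ai.
Qed.

Lemma e_wr_gen i j f : i != j -> e_wr i j f \in gen_monoid U.
Proof.
move=> ij; case/orP: (Ucov f ij) => Ue; first exact: mem_gen_monoid.
have [d Ud [d_inj dj]] := arcs_walk i j.
have ji : j != i by rewrite eq_sym.
apply: (gen_rotate (pi := fst) (i := i) (j := j)) Ud _ _ _ _ _ d_inj dj.
- exact: mem_gen_monoid Ue.
- apply: transfP => -[k x]; rewrite transf_mulE !e_wrE /=.
  have [->|_//] := eqVneq k i; first by rewrite /= eqxx permKV (negPf ij).
- exact: e_wr_idem.
- by move=> x; rewrite e_wrE => /negPf->.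
- by move=> x; rewrite e_wrE; case: (x.1 =P i) => [_|/eqP].
move=> [a x] [b y]; rewrite !inE !e_wrE /= => aj bj.
case: (a =P i) => [->|_]; case: (b =P i) => [->|_] //.
- by case=> /perm_inj->.
- by case=> bj'; rewrite -bj' eqxx in bj.
- by case=> aj'; rewrite aj' eqxx in aj.
Qed.

Lemma lift_gen g : ~~ injectiveb g -> wr (fun _ => 1) g \in gen_monoid U.
Proof.
move/noninj_gen_emaps; apply: (gen_monoid_morph (phi := wr (fun _ => 1))).
- exact: wr1.
- by move=> x y; rewrite wrM; apply: eq_wr => i; rewrite mul1g.
move=> _ /emapsP[i [j [ij ->]]].
rewrite (_ : wr _ _ = e_wr i j 1) ?e_wr_gen //.
apply: transfP => -[k x]; rewrite e_wrE wrE e_mapE transf_oneE perm1 /=.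
by case: ifP.
Qed.

(* The permutation f is applied to block l on its way to the free block c
   and back. *)
Lemma mul_at_pos_gen p c l f : (forall x, (p x).1 != c) -> p \in gen_monoid U ->
  p * at_pos l (transf_of f) \in gen_monoid U.
Proof.
move=> pc Up; have [lc|lc] := eqVneq l c.
  rewrite (_ : p * _ = p) //; apply: transfP => x.
  by rewrite transf_mulE at_posE lc (negPf (pc x)).
rewrite (_ : p * _ = p * (e_wr c l f * e_wr l c 1)).
  by rewrite !gen_monoidM // e_wr_gen // eq_sym.
apply: transfP => x; rewrite !transf_mulE at_posE !e_wrE.
by case: ifP => _ /=; rewrite ?eqxx ?transf_ofE ?perm1 // (negPf (pc x)).
Qed.

Lemma mul_perms_gen p c (fs : 'I_m -> 'S_n) : (forall x, (p x).1 != c) ->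
  p \in gen_monoid U -> p * wr (fun l => transf_of (fs l)) 1 \in gen_monoid U.
Proof.
move=> pc Up.
suff H (s : seq 'I_m) : uniq s ->
    p * wr (fun l => if l \in s then transf_of (fs l) else 1) 1 \in gen_monoid U.
  rewrite (eq_wr (hs := fun l => if l \in enum 'I_m then transf_of (fs l) else 1)).
    by rewrite H // enum_uniq.
  by move=> l; rewrite mem_enum.
elim: s => [_|l s IH /= /andP[ls /IH Us]]; first by rewrite wr1 mulg1.
rewrite (_ : _ * _ = p * wr (fun l => if l \in s then transf_of (fs l) else 1) 1
                      * at_pos l (transf_of (fs l))).
  by apply: mul_at_pos_gen Us => x; rewrite transf_mulE wrE transf_oneE; apply: pc.
rewrite -mulgA wrM; congr (_ * _); apply: transfP => x.
rewrite !wrE /= !transf_mulE !transf_oneE inE.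
by case: (x.1 =P l) => [->|_]; rewrite ?(negPf ls) ?transf_oneE.
Qed.

(** Each component factors as an element of [idem_gen_part n] followed by a permutation, one of the
    two being 1. The former come from the elements at single blocks; the permutations are postponed
    until the first idempotent of g has freed a block. *)
Lemma wr_gen fs g :
    (forall i q, q \in idem_gen_part n -> at_pos i q \in gen_monoid U) ->
  ~~ injectiveb g -> wr fs g \in gen_monoid U.
Proof.
move=> Uat gN; have [i [j [h [ij Eh gE]]]] := noninj_e_map_left gN.
pose sp l := [pick s : 'S_n | fs l == transf_of s].
pose ps l : 'S_n := odflt 1 (sp l).
pose ss l : transf 'I_n := if sp l is Some _ then 1 else fs l.
have ssE l : ss l \in idem_gen_part n.
  rewrite /ss /sp; case: pickP => [_ _|H]; first exact: gen_monoid1.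
  apply: noninj_idem_gen_part; apply/negP => /injectiveP fl.
  by case/eqP: (H (perm fl)); apply: transfP => x; rewrite transf_ofE permE.
have fsE l : fs l = ss l * transf_of (ps l).
  rewrite /ss /ps /sp; case: pickP => [s /eqP->|_] /=; first by rewrite mul1g.
  by apply: transfP => x; rewrite transf_mulE transf_ofE perm1.
have Uss : wr ss 1 \in gen_monoid U by apply: wr_one_gen => l; apply: Uat (ssE l).
rewrite (_ : wr fs g = wr ss 1 * (wr (fun l => transf_of (ps l)) 1 * e_wr i j 1
                         * wr (fun _ => 1) h)); last first.
  rewrite !wrM gE !mul1g; apply: eq_wr => l /=; rewrite !transf_oneE mulg1 fsE.
  congr (_ * _); apply: transfP => x; rewrite transf_mulE.
  by case: ifP => _; rewrite !transf_ofE ?perm1.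
rewrite gen_monoidM // gen_monoidM //; last first.
  have [/injectiveP hi|hN] := boolP (injectiveb h); last exact: lift_gen.
  rewrite (idem_gen_part_inj _ hi) ?wr1 ?gen_monoid1 //.
  by rewrite -gen_monoid_emaps.
(* The factor [(ps i)^-1] compensates for the permutation that block j meets later, after its
   arrival in block i. *)
rewrite (_ : _ * _ = e_wr i j (ps j * (ps i)^-1) * wr (fun l => transf_of (ps l)) 1).
  apply: (mul_perms_gen (c := j)); last exact: e_wr_gen.
  by move=> x; rewrite e_wrE; case: (x.1 =P j) => [_|/eqP].
apply: transfP => -[l x]; rewrite !transf_mulE wrE !e_wrE transf_oneE transf_ofE /=.
case: (l =P j) => [->|_]; rewrite wrE transf_oneE /= transf_ofE //.
by rewrite perm1 permM permKV.
Qed.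

Lemma gen_monoid_S : U \subset idempotents S ->
  (forall i, gen_monoid (comps U i) = idem_gen_part n) -> gen_monoid U = S.
Proof.
move=> /subsetP UE Uc; apply/eqP; rewrite eqEsubset; apply/andP; split.
  apply/gen_monoid_min => [||? ?]; rewrite ?gen_monoid1 //; last exact: gen_monoidM.
  by apply/subsetP => u /UE; rewrite inE => /andP[].
have Uat i q : q \in idem_gen_part n -> at_pos i q \in gen_monoid U.
  rewrite -(Uc i); apply: gen_monoid_morph; [exact: at_pos1 | exact: at_posM |].
  by move=> r; rewrite inE; apply: mem_gen_monoid.
apply: gen_monoidS; apply/subsetP => u.
rewrite inE => /andP[/T_partP[us [ub ->]]]; rewrite wrM => /eqP/wr_inj[ubb uss].
have [/injectiveP ui|uN] := boolP (injectiveb ub); last exact: wr_gen.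
have ub1 : ub = 1.
  by apply: idem_gen_part_inj ui; apply: mem_gen_monoid; rewrite !inE ubb /=.
rewrite ub1 in uss *.
apply: wr_one_gen => i; apply: Uat; apply: mem_gen_monoid; rewrite !inE /=.
by have := uss i; rewrite transf_oneE => /eqP.
Qed.

End Sufficiency.
End Wreath.

(** * Conditions forced on an idempotent generating set of S *)

Section Necessity.
Local Open Scope group_scope.

(** With the leading factors 1 discarded, e is the product of some u in [U] and a further map, so e
    identifies whatever u identifies. *)
Lemma gen_monoid_left_factor (T : finType) (U : {set transf T}) (e : transf T) :
    e \in gen_monoid U -> e != 1 ->
  exists u : transf T,
    [/\ u \in U, u != 1 & forall x y, u x = u y -> e x = e y].
Proof.
pose P (e : transf T) := (e == 1) || [exists u : transf T,
  [&& u \in U, u != 1 & [forall x, forall y, (u x == u y) ==> (e x == e y)]]].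
move=> Ue; have : P e.
  apply: (gen_monoid_ind (P := P)) Ue; first by rewrite /P eqxx.
  move=> p u _; rewrite /P => /predU1P[->|Pp] Uu.
    rewrite mul1g; have [//|u1] := eqVneq u 1; apply/existsP; exists u.
    by rewrite Uu u1; apply/forallP => x; apply/forallP => y; apply/implyP.
  case/existsP: Pp => v /and3P[Uv v1 /forallP H]; apply/orP; right.
  apply/existsP; exists v; rewrite Uv v1.
  apply/forallP => x; apply/forallP => y; apply/implyP => vxy.
  by rewrite !transf_mulE; have /forallP/(_ y)/implyP/(_ vxy)/eqP-> := H x.
case/predU1P => [->|/existsP[u /and3P[Uu u1 H]] _]; first by rewrite eqxx.
exists u; split=> // x y uxy; apply/eqP.
by move/forallP/(_ x)/forallP/(_ y)/implyP: H; apply; apply/eqP.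
Qed.

Variables m n' : nat.
Local Notation n := n'.+1.
Local Notation X := ('I_m * 'I_n)%type.
Local Notation S := (gen_monoid (idempotents (T_part m n))).
Implicit Types (p u : transf X) (fs hs : 'I_m -> transf 'I_n).
Implicit Types (g h : transf 'I_m) (U : {set transf X}) (f : 'S_n).
Implicit Types i j k l c : 'I_m.

(* u is determined by its kernel up to the choice, on each pair of points
   identified by e_{ij;f}, of the point that is fixed; since u preserves the
   partition, this choice is the same for all pairs. *)
Lemma idem_sub_ker_e_wr u i j f : i != j -> u \in T_part m n -> u * u = u ->
    u != 1 -> (forall x y, u x = u y -> e_wr i j f x = e_wr i j f y) ->
  u = e_wr i j f \/ u = e_wr j i f^-1.
Proof.
move=> ij uT uu u1 ker_u.
have uuE x : u (u x) = u x by rewrite -transf_mulE uu.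
have eu x : e_wr i j f (u x) = e_wr i j f x by apply: ker_u.
have ji : j == i = false by rewrite eq_sym; apply: negbTE.
have uj y : (u (j, y)).1 != j -> u (j, y) = (i, f y).
  by have := eu (j, y); rewrite !e_wrE /= eqxx; case: ifP.
have ui y : (u (i, y)).1 != i -> u (i, y) = (j, f^-1 y).
  have := eu (i, y); rewrite !e_wrE /= (negPf ij).
  case: eqP => [uj1 /= [fy] _|_ -> /=]; last by rewrite eqxx.
  by rewrite [LHS]surjective_pairing uj1 (canRL (permK f) fy).
have ul l y : l != i -> l != j -> u (l, y) = (l, y).
  move=> li lj; have := eu (l, y); rewrite !e_wrE /= (negPf lj).
  by case: ifP => // _ [il _]; rewrite il eqxx in li.
have ujj y : (u (j, y)).1 = j -> u (j, y) = (j, y).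
  move=> uj1; have := eu (j, y); rewrite !e_wrE uj1 !eqxx /= => -[/perm_inj uj2].
  by rewrite [LHS]surjective_pairing uj1 uj2.
have uii y : (u (i, y)).1 = i -> u (i, y) = (i, y).
  by move=> ui1; have := eu (i, y); rewrite !e_wrE ui1 /= (negPf ij).
have [/eqP uj0|uj0] := boolP ((u (j, ord0)).1 == j).
  have ujE y : u (j, y) = (j, y) by apply: ujj; rewrite (T_part_fst j y ord0 uT).
  have [/eqP ui0|ui0] := boolP ((u (i, ord0)).1 == i).
    case/eqP: u1; apply: transfP => -[l y]; rewrite transf_oneE.
    have [->|li] := eqVneq l i.
      by apply: uii; rewrite (T_part_fst i y ord0 uT).
    by have [->|lj] := eqVneq l j; [apply: ujE | apply: ul].
  right; apply: transfP => -[l y]; rewrite e_wrE /=.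
  have [->|li] := eqVneq l i; first by apply: ui; rewrite (T_part_fst i y ord0 uT).
  by have [->|lj] := eqVneq l j; [apply: ujE | apply: ul].
have ujE y : u (j, y) = (i, f y) by apply: uj; rewrite (T_part_fst j y ord0 uT).
left; apply: transfP => -[l y]; rewrite e_wrE /=.
have [->//|lj] := eqVneq l j; have [->|li] := eqVneq l i; last exact: ul.
(* Every point of block i is the image under u of a point of block j, hence is fixed by the
   idempotent u. *)
by rewrite -(permKV f y) -ujE uuE.
Qed.

Lemma card_outside_block c : #|[set x : X | x.1 != c]| = (m.-1 * n)%N.
Proof.
rewrite (_ : [set x | _] = setX [set~ c] [set: 'I_n]).
  by rewrite cardsX cardsC1 cardsT !card_ord.
by apply/setP => x; rewrite !inE andbT.
Qed.

Variable U : {set transf X}.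
Hypothesis UE : U \subset idempotents S.
Hypothesis Ugen : gen_monoid U = S.

Lemma S_T_part p : p \in S -> p \in T_part m n.
Proof.
apply: gen_monoid_ind => {p} [|p u _ /T_partP[fs [g ->]]].
  by rewrite -wr1; apply: wr_T_part.
by rewrite inE => /andP[/T_partP[us [ub ->]] _]; rewrite wrM; apply: wr_T_part.
Qed.

Lemma mem_U u : u \in U -> u \in T_part m n /\ u * u = u.
Proof. by move/(subsetP UE); rewrite inE => /andP[/S_T_part ? /eqP]. Qed.

Lemma gen_covers : covers U.
Proof.
move=> i j f ij.
have Ue : e_wr i j f \in gen_monoid U by rewrite Ugen e_wr_S.
have [u [Uu u1 ker_u]] := gen_monoid_left_factor Ue (e_wr_neq1 f ij).
have [uT uu] := mem_U Uu.
by case: (idem_sub_ker_e_wr ij uT uu u1 ker_u) => <-; rewrite Uu ?orbT.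
Qed.

(* If the kernel of p u is contained in that of e_{ij;1}, then u can only move
   a point of the image of p to another block if the image of p u misses a
   single block. *)
Lemma arc_step i j p u (x : X) : i != j -> p \in T_part m n -> u \in U ->
    (forall x y, (p * u : transf X) x = (p * u : transf X) y ->
       e_wr i j 1 x = e_wr i j 1 y) ->
  (u (p x)).1 != (p x).1 -> ((u (p x)).1, (p x).1) \in arcs U.
Proof.
move=> ij pT Uu ker_pu; have [uT uu] := mem_U Uu.
have uuE y : u (u y) = u y by rewrite -transf_mulE uu.
set b := (p x).1; set a := (u (p x)).1 => ab.
have ub y : (u (b, y)).1 = a.
  by rewrite (T_part_fst b y (p x).2 uT) -surjective_pairing.
have ua y : (u (a, y)).1 = a.
  rewrite (T_part_fst a y (u (p x)).2 uT) -surjective_pairing uuE.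
  by [].
have u_nb y : (u y).1 != b.
  apply: contra ab => /eqP uyb; have := ub (u y).2.
  by rewrite -uyb -surjective_pairing uuE => <-.
(* Off block j the map p u is injective, as e_{ij;1} is. Its values avoid block b, and counting
   shows that they fill all the rest. *)
have im_pu : [set (p * u : transf X) y | y in [set y : X | y.1 != j]]
    = [set y : X | y.1 != b].
  apply/eqP; rewrite eqEcard; apply/andP; split.
    by apply/subsetP => _ /imsetP[y _ ->]; rewrite inE transf_mulE u_nb.
  rewrite card_in_imset ?card_outside_block // => y z.
  rewrite !inE => yj zj /ker_pu; rewrite !e_wrE.
  by rewrite (negPf yj) (negPf zj).
have u_fix y : y.1 != b -> u y = y.
  move=> yb; have : y \in [set y : X | y.1 != b] by rewrite inE.
  by rewrite -im_pu => /imsetP[z _ ->]; rewrite transf_mulE uuE.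
pose r y := (u (b, y)).2.
pose q y := (p (x.1, y)).2.
have pq y : p (x.1, y) = (b, q y).
  rewrite [LHS]surjective_pairing (T_part_fst x.1 y x.2 pT).
  by rewrite -surjective_pairing.
(* On a single block e_{ij;1} is injective, hence so is p u. Thus q is injective, hence onto by
   finiteness, and r is a permutation. *)
have rq_inj : injective (r \o q).
  move=> y z rqyz.
  suff /ker_pu :
      (p * u : transf X) (x.1, y) = (p * u : transf X) (x.1, z).
    by rewrite !e_wrE /=; case: ifP => _; rewrite ?perm1 => -[].
  rewrite !transf_mulE !pq [LHS]surjective_pairing [RHS]surjective_pairing.
  by rewrite !ub; congr (_, _).
have r_inj : injective r.
  have q_inj : injective q by move=> y z qyz; apply: rq_inj; rewrite /= qyz.
  move=> y z; rewrite -(f_invF q_inj y) -(f_invF q_inj z) => ryz.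
  by congr (q _); apply: rq_inj.
rewrite inE /= ab; apply/existsP; exists (perm r_inj).
rewrite (_ : e_wr _ _ _ = u) //; apply: transfP => -[k y]; rewrite e_wrE /=.
have [->|kb] := eqVneq k b; last by rewrite u_fix.
by rewrite permE [RHS]surjective_pairing ub.
Qed.

(** A point x is followed through a product p whose kernel lies in that of e_{ij;1}, a condition
    that passes to the initial factors. Each change of block is an arc traversed backwards, so a
    directed path leads from the block of p x to that of x. For p = e_{ij;1} and x in block j, it
    leads from i to j. *)
Lemma gen_strongly_connected : strongly_connected (arcs U).
Proof.
apply/forallP => i; apply/forallP => j.
have [<-|ij] := eqVneq i j; first exact: connect0.
pose con := connect (fun x y => (x, y) \in arcs U).
pose P p := [forall x, forall y,
    (p x == p y) ==> (e_wr i j (1 : 'S_n) x == e_wr i j 1 y)]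
  ==> [forall x : X, con (p x).1 x.1].
have : P (e_wr i j 1).
  apply: (gen_monoid_ind (P := P) (U := U)); last by rewrite Ugen e_wr_S.
    by apply/implyP => _; apply/forallP => x; rewrite transf_oneE; apply: connect0.
  move=> p u Up /implyP IH Uu; apply/implyP => ker_pu; apply/forallP => x.
  have {}ker_pu y z : (p * u : transf X) y = (p * u : transf X) z ->
      e_wr i j 1 y = e_wr i j 1 z.
    move=> yz; apply/eqP; move/forallP/(_ y)/forallP/(_ z)/implyP: ker_pu; apply.
    exact/eqP.
  have /forallP/(_ x) : [forall x : X, con (p x).1 x.1].
    apply: IH; apply/forallP => y; apply/forallP => z; apply/implyP => /eqP yz.
    by apply/eqP/ker_pu; rewrite !transf_mulE yz.
  apply: connect_trans; rewrite transf_mulE.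
  have [->|ux] := eqVneq (u (p x)).1 (p x).1; first exact: connect0.
  by apply: connect1; apply: arc_step ker_pu ux => //; apply: S_T_part; rewrite -Ugen.
move/implyP; case/(_ _)/forallP/(_ (j, ord0))/Wrap.
  by apply/forallP => x; apply/forallP => y; apply/implyP.
by case; rewrite e_wrE eqxx.
Qed.

(** In a factorization of g^(i) all block maps are 1, and the components off i are injective
    elements of [idem_gen_part n], hence 1. So every factor has the form h^(i). *)
Lemma gen_comps i : gen_monoid (comps U i) = idem_gen_part n.
Proof.
apply/eqP; rewrite eqEsubset; apply/andP; split.
  apply: gen_monoidS; apply/subsetP => q; rewrite inE => /mem_U[_].
  rewrite -at_posM => /at_pos_inj qq; apply: mem_gen_monoid.
  by rewrite !inE qq /=.
apply/subsetP => q /(at_pos_S i) Sq.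
pose P p := [forall q, (p == at_pos i q) ==> (q \in gen_monoid (comps U i))].
suff : P (at_pos i q) by move/forallP/(_ q)/implyP; apply.
rewrite -Ugen in Sq.
apply: (gen_monoid_ind (P := P)) Sq => [|p u Up IH Uu].
  apply/forallP => r; apply/implyP => /eqP; rewrite -(at_pos1 _ i) => /at_pos_inj <-.
  exact: gen_monoid1.
apply/forallP => r; apply/implyP => /eqP.
rewrite Ugen in Up; have Su : u \in S by rewrite -Ugen mem_gen_monoid.
have /T_partP[ps [pb pE]] := S_T_part Up.
have /T_partP[us [ub uE]] := S_T_part Su.
move: Up IH Su Uu; rewrite {}pE {}uE.
move=> /gen_T_part_wr[pbE psE] IH /gen_T_part_wr[ubE usE] Uu.
rewrite wrM => /wr_inj[pub1 pusE].
have pb1 : pb = 1.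
  apply: idem_gen_part_inj => // x y xy.
  by rewrite -(transf_oneE x) -(transf_oneE y) -pub1 !transf_mulE xy.
have ub1 : ub = 1 by rewrite -pub1 pb1 mul1g.
move: IH Uu pusE; rewrite {}pb1 {}ub1 in psE usE * => IH Uu pusE.
have pus l : l != i -> ps l = 1 /\ us l = 1.
  move=> li; have := pusE l; rewrite transf_oneE (negPf li) => pu1.
  have p1 : ps l = 1.
    apply: idem_gen_part_inj; first exact: psE.
    by move=> x y xy; rewrite -(transf_oneE x) -(transf_oneE y) -pu1 !transf_mulE xy.
  by split=> //; rewrite -pu1 p1 mul1g.
have := pusE i; rewrite transf_oneE eqxx => <-.
apply: gen_monoidM.
  move/forallP/(_ (ps i))/implyP: IH; apply; apply/eqP; apply: eq_wr => l.
  by have [->//|/pus[]] := eqVneq l i.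
apply: mem_gen_monoid; rewrite inE (_ : at_pos _ _ = wr us 1) //.
by apply: eq_wr => l; have [->//|/pus[]] := eqVneq l i.
Qed.

End Necessity.

(** * Blocks of size one: idempotent generating sets of [idem_gen_part k] *)

Section FullTransformations.
Local Open Scope group_scope.
Variable k : nat.
Implicit Types (g h : transf 'I_k) (V : {set transf 'I_k}) (i j : 'I_k).

(** Since [e_map i i] is the identity, the inequality prevents 1 from producing loops. *)
Definition dig V : {set 'I_k * 'I_k} :=
  [set q | (q.1 != q.2) && (e_map q.1 q.2 \in V)].

Lemma in_dig V i j : ((i, j) \in dig V) = (i != j) && (e_map i j \in V).
Proof. by rewrite inE. Qed.

Lemma complete_digP V :
  reflect (forall i j, i != j -> (e_map i j \in V) || (e_map j i \in V))
          (complete_digraph (dig V)).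
Proof.
apply: (iffP andP) => [[_ /forallP H] i j ij|H].
  move/forallP/(_ j): (H i); rewrite ij !in_dig ij /=.
  by case/orP => [->//|/andP[_ ->]]; rewrite orbT.
split; first by apply/forallP => u; rewrite in_dig eqxx.
apply/forallP => i; apply/forallP => j; apply/implyP => ij.
by rewrite !in_dig [j == i]eq_sym ij; apply: H.
Qed.

(* The monoid generated by the idempotents of the full transformation monoid
   is treated as the case of blocks of size 1. *)
Let lift g : transf ('I_k * 'I_1)%type := wr (fun _ => 1) g.
Local Notation S := (gen_monoid (idempotents (T_part k 1))).

Let liftM : {morph lift : g h / g * h}.
Proof. by move=> g h; rewrite wrM; apply: eq_wr => i; rewrite mul1g. Qed.

Let lift_inj : injective lift.
Proof. by move=> g h /wr_inj[]. Qed.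

Lemma transf_ord1 (f : transf 'I_1) : f = 1.
Proof. by apply: transfP => x; rewrite transf_oneE (ord1 (f x)) (ord1 x). Qed.

Let wr_lift fs g : wr fs g = lift g.
Proof. by apply: eq_wr => i; apply: transf_ord1. Qed.

Let lift_gen_monoid V : gen_monoid (lift @: V) = lift @: gen_monoid V.
Proof.
apply/eqP; rewrite eqEsubset; apply/andP; split.
  apply: gen_monoid_min; first by apply/imsetS/gen_monoid_sub.
    by apply/imsetP; exists 1; rewrite ?gen_monoid1 // /lift wr1.
  move=> _ _ /imsetP[g Vg ->] /imsetP[h Vh ->].
  by rewrite -liftM imset_f // gen_monoidM.
apply/subsetP => _ /imsetP[g Vg ->].
apply: (gen_monoid_morph _ liftM) Vg; first exact: wr1.
by move=> u Vu; apply/mem_gen_monoid/imset_f.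
Qed.

Let S_lift : S = lift @: idem_gen_part k.
Proof.
rewrite -lift_gen_monoid; congr gen_monoid; apply/setP => p.
rewrite [LHS]inE; apply/andP/imsetP => [[/T_partP[fs [g ->]]]|[g]].
  rewrite wr_lift -liftM => /eqP/lift_inj gg; exists g => //.
  by rewrite !inE gg /=.
rewrite !inE /= => /eqP gg ->; rewrite -liftM gg; split=> //.
by have := @wr_T_part k 0 (fun=> 1) g; rewrite inE.
Qed.

Let e_wr_lift i j f V : (e_wr i j f \in lift @: V) = (e_map i j \in V).
Proof. by rewrite [e_wr i j f]wr_lift mem_imset. Qed.

Let lift_idem V :
  V \subset idempotents (idem_gen_part k) -> lift @: V \subset idempotents S.
Proof.
move/subsetP => VE; apply/subsetP => _ /imsetP[g /VE gE ->]; move: gE.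
by rewrite !inE => /andP[gE /eqP gg]; rewrite -liftM gg S_lift imset_f /=.
Qed.

Let arcs_lift V : arcs (lift @: V) = dig V.
Proof.
apply/setP => -[i j]; rewrite in_dig inE; congr (_ && _).
apply/existsP/idP => [[f]|Vij]; first by rewrite e_wr_lift.
by exists 1; rewrite e_wr_lift.
Qed.

Lemma gen_monoid_digP V : V \subset idempotents (idem_gen_part k) ->
  gen_monoid V = idem_gen_part k <->
  complete_digraph (dig V) /\ strongly_connected (dig V).
Proof.
move=> VE; split=> [Vgen|[/complete_digP Vc Vsc]].
  have Ugen : gen_monoid (lift @: V) = S by rewrite lift_gen_monoid Vgen S_lift.
  split; last by rewrite -arcs_lift; apply: gen_strongly_connected (lift_idem VE) Ugen.
  apply/complete_digP => i j ij.
  by have := gen_covers (lift_idem VE) Ugen 1 ij; rewrite !e_wr_lift.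
apply: (imset_inj lift_inj); rewrite -lift_gen_monoid -S_lift.
apply: gen_monoid_S (lift_idem VE) _.
- by move=> i j f ij; rewrite !e_wr_lift Vc.
- by rewrite arcs_lift.
- move=> i; apply/setP => f; rewrite (transf_ord1 f) /idem_gen_part.
  by rewrite !gen_monoid1.
Qed.

(** A product ending in e_{ij} misses j, so it is not 1 and the semigroup is the monoid without 1.
    The only injective element of [idem_gen_part k] is 1, which leaves exactly the non-injective
    maps. *)
Lemma gen_semigroup_dig V : V \subset emaps k ->
    complete_digraph (dig V) -> strongly_connected (dig V) ->
  gen_semigroup V = [set: transf 'I_k] :\: sym_group k.
Proof.
move=> /subsetP VE Vc Vsc.
rewrite gen_semigroupE => [|f g _ /VE/emapsP[i [j [ij ->]]]].
  rewrite (proj2 (gen_monoid_digP _)) //; last first.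
    apply/subsetP => _ /VE/emapsP[i [j [ij ->]]].
    by rewrite inE -gen_monoid_emaps mem_gen_monoid ?mem_emaps // e_map_idem /=.
  apply/setP => f; rewrite in_setD1 !inE andbT.
  have [/injectiveP fi|fN] := boolP (injectiveb (f : transf 'I_k)).
    have -> : f \in sym_group k.
      apply/imsetP; exists (perm fi) => //.
      by apply: transfP => x; rewrite transf_ofE permE.
    by apply/negP => /andP[/eqP f1 fE]; apply/f1/idem_gen_part_inj.
  rewrite noninj_idem_gen_part // andbT.
  transitivity true; last apply/esym.
    by apply: contraNneq fN => ->; apply/injectiveP => x y; rewrite !transf_oneE.
  apply: contra fN => /imsetP[s _ ->]; apply/injectiveP => x y.
  by rewrite !transf_ofE => /perm_inj.
apply/eqP => fe1; have := transf_oneE j; rewrite -fe1 transf_mulE e_mapE.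
by case: eqP => // _ ij0; rewrite ij0 eqxx in ij.
Qed.

End FullTransformations.

(** * Minimal generating sets and complete digraphs *)

Section MinimalFamily.
Variables (T : finType) (A : {set transf T}) (F : {set {set transf T}}).
Hypothesis F_gen : forall U, U \in F -> idem_gen_set A U.
Hypothesis F_sub :
  forall U, idem_gen_set A U -> exists2 U', U' \in F & U' \subset U.
Hypothesis F_card : forall U U', U \in F -> U' \in F -> #|U| = #|U'|.

(** A generating set of least size contains a member of [F], which cannot be smaller and so equals
    it. Every generating set is at least as large as the common size of the members. *)
Lemma min_idem_gen_setE U : min_idem_gen_set A U = (U \in F).
Proof.
apply/andP/idP => [[Ugen /forallP Umin]|FU].
  have [U' FU' U'U] := F_sub Ugen.
  have /implyP/(_ (F_gen FU')) le := Umin U'.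
  by rewrite -(eqP (_ : U' == U)) // eqEcard U'U.
split; first exact: F_gen.
apply/forallP => U'; apply/implyP => /F_sub[U'' FU'' /subset_leq_card].
by rewrite (F_card FU FU'').
Qed.

End MinimalFamily.

(** * Strongly connected complete digraphs and tournaments *)

Section CompleteDigraphs.
Variable k : nat.
Implicit Types (G : {set 'I_k * 'I_k}) (Q : {set 'I_k}) (u v w x y : 'I_k).

Lemma strongly_connectedP G :
  reflect (forall x y, connect (fun x y => (x, y) \in G) x y)
          (strongly_connected G).
Proof.
apply: (iffP forallP) => [H x y|H x]; first by have /forallP := H x.
exact/forallP.
Qed.

Lemma complete_digraphP G :
  reflect ((forall x, (x, x) \notin G) /\
           (forall x y, x != y -> ((x, y) \in G) || ((y, x) \in G)))
          (complete_digraph G).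
Proof.
apply: (iffP andP) => -[].
  move=> /forallP Gl /forallP Gc; split=> // x y xy.
  by have /forallP/(_ y)/implyP/(_ xy) := Gc x.
move=> Gl Gc; split; first exact/forallP.
by apply/forallP => x; apply/forallP => y; apply/implyP; apply: Gc.
Qed.

Lemma connect_closed G Q x y :
    (forall a b, (a, b) \in G -> a \in Q -> b \in Q) ->
  connect (fun x y => (x, y) \in G) x y -> x \in Q -> y \in Q.
Proof.
move=> QG /connectP[p]; elim: p x => [|z p IH] x /=; first by move=> _ ->.
by case/andP=> xz pz yl Qx; apply: IH pz yl _; apply: QG xz Qx.
Qed.

(* In a strongly connected complete digraph that is minimal for inclusion, a
   double edge u <-> v would make u and v the only vertices: if K is reachable
   from u without u -> v, and L from v without v -> u, then K minus u equals
   L minus v and no edge leaves it, and no edge enters the complement of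
   K and L. *)
Lemma sub_tournament G : 2 < k -> complete_digraph G -> strongly_connected G ->
  exists G', [/\ G' \subset G, tournament G' & strongly_connected G'].
Proof.
move=> k2 Gc Gsc.
pose P G := complete_digraph G && strongly_connected G.
have [H /minsetP[/andP[Hc Hsc] Hmin] HG] : {H | minset P H & H \subset G}.
  by apply: minset_exists; rewrite /P Gc.
exists H; split=> //; have [Hl Ht] := complete_digraphP _ Hc.
apply/andP; split; first exact/forallP.
apply/forallP => u; apply/forallP => v; apply/implyP => uv.
have := Ht u v uv; case Huv: ((u, v) \in H); case Hvu: ((v, u) \in H) => // _.
(* A path from a to b avoiding the edge itself would allow its deletion: completeness survives
   through the reverse edge, against the minimality of [H]. *)
have hop a b : a != b -> (a, b) \in H -> (b, a) \in H ->
    connect (fun x y => (x, y) \in H :\ (a, b)) a b = false.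
  move=> ab Hab Hba; apply/negP => con.
  suff /(Hmin _) E : P (H :\ (a, b)).
    by have := Hab; rewrite -E ?subD1set // !inE eqxx.
  apply/andP; split.
    apply/complete_digraphP; split=> [z|z w zw].
      by rewrite !inE negb_and Hl orbT.
    have ba : (b, a) != (a, b) by rewrite xpair_eqE negb_and [b == a]eq_sym ab.
    have [[-> ->]|/eqP zwN] := (z, w) =P (a, b).
      by rewrite !in_setD1 ba Hba orbT.
    have [[-> ->]|/eqP wzN] := (w, z) =P (a, b); first by rewrite !in_setD1 ba Hba.
    by rewrite !in_setD1 zwN wzN Ht.
  apply/strongly_connectedP => x' y'.
  apply: connect_sub (strongly_connectedP _ Hsc x' y') => z w Hzw.
  have [[-> ->]//|/eqP zw] := (z, w) =P (a, b).
  by apply: connect1; rewrite !inE zw.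
have vu : v != u by rewrite eq_sym.
pose K := [set x | connect (fun x y => (x, y) \in H :\ (u, v)) u x].
pose L := [set x | connect (fun x y => (x, y) \in H :\ (v, u)) v x].
have vK : v \notin K by rewrite inE hop.
have uL : u \notin L by rewrite inE hop.
have uK : u \in K by rewrite inE connect0.
have vL : v \in L by rewrite inE connect0.
have KH x y : x \in K -> (x, y) \in H -> (x, y) != (u, v) -> y \in K.
  rewrite !inE => ux Hxy xy; apply: connect_trans ux _.
  by apply: connect1; rewrite !inE xy.
have LH x y : x \in L -> (x, y) \in H -> (x, y) != (v, u) -> y \in L.
  rewrite !inE => ux Hxy xy; apply: connect_trans ux _.
  by apply: connect1; rewrite !inE xy.
have [w /andP[wu wv]] : exists w, (w != u) && (w != v).
  apply/existsP; rewrite -[X in is_true X]negbK negb_exists; apply/negP => /forallP no.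
  have : #|[set: 'I_k]| <= #|[set u; v]|.
    by apply/subset_leq_card/subsetP => x _; have := no x; rewrite !inE negb_and !negbK.
  by rewrite cardsT card_ord cards2 uv leqNgt k2.
have KL x : x != u -> x != v -> (x \in K) = (x \in L).
  move=> xu xv; apply/idP/idP => Qx.
    have : (x, v) \notin H.
      by apply: contra vK => Hxv; apply: KH Qx Hxv _; rewrite xpair_eqE (negPf xu).
    case/orP: (Ht x v xv) => [->//|Hvx] _.
    by apply: LH vL Hvx _; rewrite xpair_eqE (negPf xu) andbF.
  have : (x, u) \notin H.
    by apply: contra uL => Hxu; apply: LH Qx Hxu _; rewrite xpair_eqE (negPf xv).
  case/orP: (Ht x u xu) => [->//|Hux] _.
  by apply: KH uK Hux _; rewrite xpair_eqE (negPf xv) andbF.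
have [wK|wK] := boolP (w \in K).
  have : u \in K :&: L.
    apply: connect_closed (strongly_connectedP _ Hsc w u) _; last by rewrite inE -KL // wK.
    move=> a b Hab; rewrite !in_setI => /andP[aK aL].
    have au : a != u by apply: contraNneq uL => <-.
    have av : a != v by apply: contraNneq vK => <-.
    apply/andP; split.
      by apply: KH aK Hab _; rewrite xpair_eqE (negPf au).
    by apply: LH aL Hab _; rewrite xpair_eqE (negPf av).
  by rewrite inE (negPf uL) andbF.
have : w \in K :|: L.
  apply: connect_closed (strongly_connectedP _ Hsc u w) _; last by rewrite inE uK.
  move=> a b Hab; rewrite !in_setU => /orP[aK|aL].
    have [[_ ->]|/eqP ab] := (a, b) =P (u, v); first by rewrite vL orbT.
    by rewrite (KH a).
  have [[_ ->]|/eqP ab] := (a, b) =P (v, u); first by rewrite uK.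
  by rewrite (LH a) ?orbT.
by rewrite inE -KL // (negPf wK).
Qed.

Definition off_diagonal : {set 'I_k * 'I_k} := [set q | q.1 != q.2].

Lemma tournament_complete G : tournament G -> complete_digraph G.
Proof.
case/andP=> Gl /forallP Gt; apply/andP; split=> //.
apply/forallP => x; apply/forallP => y; apply/implyP => xy.
by have /forallP/(_ y) := Gt x; rewrite xy /= => /addbP; case: (_ \in G) => // ->.
Qed.

(** A tournament and its reverse partition the off-diagonal pairs; hence all tournaments have
    equally many edges. *)
Lemma card_tournament G : tournament G -> #|G|.*2 = #|off_diagonal|.
Proof.
case/andP=> /forallP Gl /forallP Gt.
have swapK : involutive (fun q : 'I_k * 'I_k => (q.2, q.1)) by case.
pose G' := [set (q.2, q.1) | q in G].
have G'E x y : ((x, y) \in G') = ((y, x) \in G).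
  by rewrite -[(x, y)]/((y, x).2, (y, x).1) mem_imset //; apply: inv_inj.
have <- : G :|: G' = off_diagonal.
  apply/setP => -[x y]; rewrite in_setU G'E inE /=.
  have [->|xy] := eqVneq x y; first by rewrite (negPf (Gl y)).
  by have /forallP/(_ y) := Gt x; rewrite xy /=; do 2!case: (_ \in G).
rewrite cardsU (_ : G :&: G' = set0) ?cards0 ?subn0.
  by rewrite card_imset ?addnn //; apply: inv_inj.
apply/setP => -[x y]; rewrite !inE G'E.
have [->|xy] := eqVneq x y; first by rewrite (negPf (Gl y)).
by have /forallP/(_ y) := Gt x; rewrite xy /=; do 2!case: (_ \in G).
Qed.

Definition edge_maps G : {set transf 'I_k} := [set e_map q.1 q.2 | q in G].

Lemma edge_maps_sub G : loopless G -> edge_maps G \subset emaps k.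
Proof.
move/forallP => Gl; apply/subsetP => _ /imsetP[[i j] Gij ->].
by apply: mem_emaps; apply: contraTneq Gij => /= ->; apply: Gl.
Qed.

Lemma dig_edge_maps G : loopless G -> dig (edge_maps G) = G.
Proof.
move/forallP => Gl; apply/setP => -[i j]; rewrite in_dig.
apply/andP/idP => [[ij /imsetP[[i' j'] Gij]]|Gij].
  by case/(e_map_inj ij) => -> ->.
split; last by apply/imsetP; exists (i, j).
by apply: contraTneq Gij => /= ->; apply: Gl.
Qed.

Lemma edge_maps_dig (V : {set transf 'I_k}) : edge_maps (dig V) \subset V.
Proof.
by apply/subsetP => _ /imsetP[[i j] + ->]; rewrite in_dig => /andP[].
Qed.

Lemma card_edge_maps G : loopless G -> #|edge_maps G| = #|G|.
Proof.
move/forallP => Gl; apply: card_in_imset => -[i j] [i' j'] Gij _ /= /e_map_inj.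
by case=> [|-> ->//]; apply: contraTneq Gij => ->; apply: Gl.
Qed.

End CompleteDigraphs.

(** * Minimal idempotent generating sets of [idem_gen_part n] *)

Section MinimalTn.
Variable n : nat.
Hypothesis n_ge2 : 1 < n.

(** No tournament on two vertices is strongly connected; there the double edge is the only
    possibility, whence the value 1 of [sigma 2]. *)
Definition min_digraphs : {set {set 'I_n * 'I_n}} :=
  if n == 2 then [set off_diagonal n]
  else [set G | tournament G && strongly_connected G].

Definition min_gen_sets : {set {set transf 'I_n}} :=
  [set edge_maps G | G in min_digraphs].

Lemma min_digraphs_complete G : G \in min_digraphs ->
  complete_digraph G /\ strongly_connected G.
Proof.
rewrite /min_digraphs; case: ifP => _; rewrite inE; last first.
  by case/andP=> /tournament_complete.
move/eqP->; split.
  apply/complete_digraphP; split=> [x|x y]; first by rewrite inE eqxx.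
  by rewrite !inE => ->.
apply/strongly_connectedP => x y; have [->|xy] := eqVneq x y; first exact: connect0.
by apply: connect1; rewrite inE.
Qed.

Lemma min_digraphs_sub G : complete_digraph G -> strongly_connected G ->
  exists2 G', G' \in min_digraphs & G' \subset G.
Proof.
move=> Gc Gsc; rewrite /min_digraphs; case: eqP => [n2|/eqP nn2]; last first.
  have [|G' [sub tG' scG']] := sub_tournament _ Gc Gsc.
    by rewrite ltn_neqAle eq_sym nn2.
  by exists G' => //; rewrite inE tG'.
exists (off_diagonal n); first by rewrite inE.
have only2 (x y z : 'I_n) : x != y -> z != x -> z = y.
  move=> xy zx; apply/eqP; apply: contraTT isT => zy.
  have : #|[set x; y; z]| <= n by rewrite -[X in _ <= X]card_ord max_card.
  by rewrite setUC cardsU1 cards2 xy !inE (negPf zx) (negPf zy) n2.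
apply/subsetP => -[x y]; rewrite inE /= => xy.
have : y \notin [set x] by rewrite inE eq_sym.
apply: contraNT => Gxy.
(* Without the edge from x to y, no edge would leave x towards the only other vertex. *)
apply: (connect_closed _ (strongly_connectedP _ Gsc x y)); last by rewrite inE.
move=> a b Gab; rewrite !inE => /eqP ax; apply: contraNT Gxy => bx.
by rewrite -ax -(only2 x y b xy bx).
Qed.

Lemma min_digraphs_card G G' :
  G \in min_digraphs -> G' \in min_digraphs -> #|G| = #|G'|.
Proof.
rewrite /min_digraphs; case: ifP => _; rewrite !inE; first by move=> /eqP-> /eqP->.
move=> /andP[tG _] /andP[tG' _]; apply: double_inj.
by rewrite !card_tournament.
Qed.

Lemma complete_loopless (G : {set 'I_n * 'I_n}) : complete_digraph G -> loopless G.
Proof. by case/andP. Qed.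

Lemma min_gen_sets_gen U : U \in min_gen_sets -> idem_gen_set (idem_gen_part n) U.
Proof.
case/imsetP=> G /min_digraphs_complete[Gc Gsc] ->.
have Gl := complete_loopless Gc.
have UE : edge_maps G \subset idempotents (idem_gen_part n).
  apply: subset_trans (edge_maps_sub Gl) _; apply/subsetP => _ /emapsP[i [j [ij ->]]].
  by rewrite inE -gen_monoid_emaps mem_gen_monoid ?mem_emaps // e_map_idem /=.
apply/andP; split=> //; apply/eqP; apply: (proj2 (gen_monoid_digP UE)).
by rewrite dig_edge_maps.
Qed.

Lemma min_gen_sets_sub U : idem_gen_set (idem_gen_part n) U ->
  exists2 U', U' \in min_gen_sets & U' \subset U.
Proof.
case/andP=> UE /eqP/(proj1 (gen_monoid_digP UE))[Gc Gsc].
have [G' mG' G'U] := min_digraphs_sub Gc Gsc.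
exists (edge_maps G'); first exact: imset_f.
by apply: subset_trans (edge_maps_dig U); apply: imsetS.
Qed.

Lemma min_gen_sets_card U U' :
  U \in min_gen_sets -> U' \in min_gen_sets -> #|U| = #|U'|.
Proof.
case/imsetP=> G mG -> /imsetP[G' mG' ->].
have [/complete_loopless lG _] := min_digraphs_complete mG.
have [/complete_loopless lG' _] := min_digraphs_complete mG'.
by rewrite !card_edge_maps // (min_digraphs_card mG mG').
Qed.

Lemma min_idem_gen_set_part U :
  min_idem_gen_set (idem_gen_part n) U = (U \in min_gen_sets).
Proof.
exact: (min_idem_gen_setE min_gen_sets_gen min_gen_sets_sub min_gen_sets_card).
Qed.

Lemma min_gen_sets_neq1 U u : U \in min_gen_sets -> u \in U -> u != 1%g.
Proof.
case/imsetP=> G /min_digraphs_complete[/complete_loopless Gl _] ->.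
by move/(subsetP (edge_maps_sub Gl))/emapsP => [i [j [ij ->]]]; apply: e_map_neq1.
Qed.

Lemma card_min_gen_sets : #|min_gen_sets| = sigma n.
Proof.
rewrite card_in_imset => [|G G' mG mG' E]; last first.
  have [/complete_loopless lG _] := min_digraphs_complete mG.
  have [/complete_loopless lG' _] := min_digraphs_complete mG'.
  by rewrite -(dig_edge_maps lG) E dig_edge_maps.
by rewrite /min_digraphs /sigma; case: ifP => _; rewrite ?cards1.
Qed.

End MinimalTn.

(** * Enumeration of complete digraphs by their double edges *)

Section Counting.
Variable m : nat.
Implicit Types (G : {set 'I_m * 'I_m}).

(** Each double edge is represented by its increasing pair, as in [Xi]. *)
Definition ordered_double_edges G : {set 'I_m * 'I_m} :=
  [set q : 'I_m * 'I_m | [&& q.1 < q.2, q \in G & (q.2, q.1) \in G]].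

Lemma card_double_edges G : loopless G ->
  #|double_edges G| = #|ordered_double_edges G|.
Proof.
move/forallP => Gl.
have -> : double_edges G = [set [set q.1; q.2] | q in ordered_double_edges G].
  apply/setP => D; apply/imsetP/imsetP => -[[i j]]; rewrite inE /=.
    case/andP=> Gij Gji ->; case: (ltngtP i j) => [ij|ji|ij].
    - by exists (i, j); rewrite // inE /= ij Gij.
    - by exists (j, i); rewrite 1?setUC // inE /= ji Gji.
    - by move: Gij (Gl i); rewrite (val_inj ij) => ->.
  by case/and3P=> _ Gij Gji ->; exists (i, j); rewrite // inE /= Gij.
apply: card_in_imset => -[i j] [i' j']; rewrite !inE /=.
case/and3P=> ij _ _ /and3P[ij' _ _] /setP E.
have := E i; have := E j; rewrite !inE !eqxx orbT /=.
move=> /esym/orP[]/eqP jE /esym/orP[]/eqP iE; move: ij;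
  rewrite iE jE ?ltnn // => ij.
by have := ltn_trans ij ij'; rewrite ltnn.
Qed.

Lemma card_double_edges_le G : loopless G -> #|double_edges G| <= 'C(m, 2).
Proof.
move/forallP => Gl; rewrite -[X in 'C(X, 2)]card_ord -card_draws.
apply/subset_leq_card/subsetP => _ /imsetP[[i j] + ->]; rewrite !inE /=.
case/andP=> Gij _; rewrite cards2.
by have -> : i != j by apply: contraTneq Gij => ->; apply: Gl.
Qed.

Lemma sum_double_edges c :
  \sum_(G : {set 'I_m * 'I_m} | complete_digraph G && strongly_connected G)
     c ^ #|double_edges G|
  = \sum_(0 <= k < 'C(m, 2).+1) w2 m k * c ^ k.
Proof.
rewrite big_mkord.
(* There are at most ['C(m, 2)] double edges, so [inord] does not alter their number. *)
rewrite (partition_big (fun G => inord #|double_edges G| : 'I_('C(m, 2).+1)) xpredT) //=.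
apply: eq_bigr => k _; rewrite /w2 -sum_nat_const.
apply: eq_big => [G|G].
  rewrite inE -andbA; apply: andb_id2l => /andP[Gl _]; apply: andb_id2l => _.
  by rewrite -val_eqE /= inordK // ltnS card_double_edges_le.
case/andP=> /andP[/andP[Gl _] _] /eqP <-.
by rewrite inordK // ltnS card_double_edges_le.
Qed.

End Counting.

(** * Selections of one idempotent for each kernel *)

Section Families.
Variables m n' : nat.
Local Notation n := n'.+2.
Local Notation X := ('I_m * 'I_n)%type.
Local Notation S := (gen_monoid (idempotents (T_part m n))).
Local Notation arrow := ('I_m * 'I_m * 'S_n)%type.
Implicit Types (G : {set 'I_m * 'I_m}) (T : {set arrow}) (f : 'S_n).
Implicit Types (i j : 'I_m) (U : {set transf X}).
Implicit Type Us : {ffun 'I_m -> {set transf 'I_n}}.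

(* The triple (i, j, f) stands for e_{ij;f}, which has the same kernel as
   e_{ji;f^-1}. *)
Definition arrow_graph T : {set 'I_m * 'I_m} :=
  [set q | [exists f, (q, f) \in T]].

(** The triples (i, j, f) and (j, i, f^-1) form a pair of equal kernel; a set with this property
    picks one triple from each pair. *)
Definition antisym T : bool :=
  [forall i, forall j, forall f,
    ((i, j, f) \in T) ==> (i != j)] &&
  [forall i, forall j, forall f,
    (i != j) ==> ((i, j, f) \in T) (+) ((j, i, f^-1%g) \in T)].

Definition orientations : {set {set arrow}} :=
  [set T | antisym T && strongly_connected (arrow_graph T)].

Lemma antisymP T : reflect
  ((forall i j f, (i, j, f) \in T -> i != j) /\
   (forall i j f, i != j -> ((i, j, f) \in T) = ((j, i, f^-1%g) \notin T)))
  (antisym T).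
Proof.
apply: (iffP andP) => -[H1 H2]; split.
- by move=> i j f; move/forallP/(_ i)/forallP/(_ j)/forallP/(_ f)/implyP: H1.
- move=> i j f ij; move/forallP/(_ i)/forallP/(_ j)/forallP/(_ f): H2.
  by rewrite ij; do 2!case: (_ \in T).
- apply/forallP => i; apply/forallP => j; apply/forallP => f.
  by apply/implyP; apply: H1.
apply/forallP => i; apply/forallP => j; apply/forallP => f; apply/implyP => ij.
by rewrite H2 //; case: (_ \in T).
Qed.

Lemma arrow_graphP T i j :
  reflect (exists f, (i, j, f) \in T) ((i, j) \in arrow_graph T).
Proof. by rewrite inE; apply: existsP. Qed.

Lemma antisym_complete T : antisym T -> complete_digraph (arrow_graph T).
Proof.
case/antisymP=> Tirr Tanti; apply/complete_digraphP; split=> [i|i j ij].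
  by apply/arrow_graphP => -[f /Tirr]; rewrite eqxx.
have := Tanti i j 1%g ij; case: (boolP (_ \in T)) => [Tij _|_ /esym/negbFE Tji].
  by apply/orP; left; apply/arrow_graphP; exists 1%g.
by apply/orP; right; apply/arrow_graphP; exists (1^-1)%g.
Qed.

(** The involution exchanging the two triples of a pair maps [T] onto its complement among the
    triples with distinct ends, so all selections have the same size. *)
Lemma card_antisym T : antisym T ->
  #|T|.*2 = #|[set t : arrow | t.1.1 != t.1.2]|.
Proof.
case/antisymP=> Tirr Tanti.
pose flip (t : arrow) : arrow := (t.1.2, t.1.1, t.2^-1%g).
have flipK : involutive flip by move=> [[i j] f]; rewrite /flip /= invgK.
have flipE i j f : ((i, j, f) \in flip @: T) = ((j, i, f^-1%g) \in T).
  by rewrite -{1}(flipK (i, j, f)) mem_imset //; apply: inv_inj.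
have <- : T :|: flip @: T = [set t : arrow | t.1.1 != t.1.2].
  apply/setP => -[[i j] f]; rewrite in_setU flipE inE /=.
  have [<-|ij] := eqVneq i j; last by rewrite Tanti // orNb.
  by apply/negbTE/negP => /orP[] /Tirr; rewrite eqxx.
rewrite cardsU (_ : T :&: _ = set0) ?cards0 ?subn0.
  by rewrite card_imset ?addnn //; apply: inv_inj.
apply/setP => -[[i j] f]; rewrite in_setI flipE inE.
by apply/negP => /andP[Tij]; apply/negP; rewrite -Tanti // (Tirr _ _ _ Tij).
Qed.

Section Fiber.
Variable G : {set 'I_m * 'I_m}.
Hypothesis Gc : complete_digraph G.
Hypothesis Gsc : strongly_connected G.

Let splits : {set {set 'S_n}} := [set A | (A != set0) && (A != setT)].

(** A single edge of [G] carries all of S_n. On a double edge with i < j, [phi (i, j)] is the set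
    A_{ij}, and its complement, inverted, labels the direction from j to i. *)
Let Tof (phi : {ffun 'I_m * 'I_m -> {set 'S_n}}) : {set arrow} :=
  [set t : arrow | (t.1 \in G) &&
    (((t.1.2, t.1.1) \in G) ==>
      if t.1.1 < t.1.2 then t.2 \in phi t.1
      else (t.2^-1)%g \notin phi (t.1.2, t.1.1))].

Let card_splits : #|splits| = 2 ^ n`! - 2.
Proof.
rewrite (_ : splits = ~: [set set0; setT]).
  rewrite cardsCs setCK cards2 eq_sym -card_gt0 cardsT card_Sn fact_gt0.
  by rewrite -cardsT -powersetT card_powerset cardsT card_Sn.
by apply/setP => A; rewrite !inE negb_or.
Qed.

(** The selection is forced on single edges and free on double ones, where both directions occur
    exactly when the chosen subset of S_n is neither empty nor full. *)
Lemma card_fiber :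
  #|[set T in orientations | arrow_graph T == G]|
  = (2 ^ n`! - 2) ^ #|ordered_double_edges G|.
Proof.
have [Gl Gt] := complete_digraphP _ Gc.
have Girr i j : (i, j) \in G -> i != j.
  by apply: contraTneq => ->; apply: Gl.
(* The value off the double edges is fixed to be [set0], so that [Tof] is injective on the functions
   counted. *)
rewrite -card_splits -(card_pffun_on set0) -[RHS]cardsE.
set R := [set _ in _]; have RP (phi : {ffun 'I_m * 'I_m -> {set 'S_n}}) : reflect
   (forall q, if q \in ordered_double_edges G then is_true (phi q \in splits)
     else phi q = set0)
   (phi \in R).
  rewrite in_set; apply: (iffP familyP) => H q; have := H q; case: ifP => //= _.
    by rewrite inE => /eqP.
  by rewrite inE => ->.
have TofE (phi : {ffun 'I_m * 'I_m -> {set 'S_n}}) i j f :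
    i < j -> (i, j) \in G -> (j, i) \in G ->
  ((i, j, f) \in Tof phi) = (f \in phi (i, j)).
  by move=> ij Gij Gji; rewrite inE /= Gij Gji ij.
rewrite -[RHS](card_in_imset (f := Tof)) => [|phi psi /RP Hphi /RP Hpsi E].
  congr #|pred_of_set _|; apply/setP => T; rewrite inE; apply/andP/imsetP.
    rewrite inE => -[/andP[/antisymP[Tirr Tanti] Tsc] /eqP TG].
    pose phi := [ffun q => if q \in ordered_double_edges G
                           then [set f | (q, f) \in T] else set0].
    exists phi.
      apply/RP => -[i j]; case: ifP => Dij; rewrite ffunE Dij //.
      move: Dij; rewrite inE /= -TG => /and3P[_ /arrow_graphP[f Tf] /arrow_graphP[h Th]].
      rewrite inE; apply/andP; split.
        by apply/set0Pn; exists f; rewrite inE.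
      apply/eqP => /setP/(_ (h^-1)%g); rewrite !inE => Th'.
      by have := Tanti _ _ h (Tirr _ _ _ Th); rewrite Th Th'.
    apply/setP => -[[i j] f]; rewrite [RHS]inE /=.
    have [Gij|Gij] := boolP ((i, j) \in G); last first.
      by apply/negbTE; apply: contra Gij => Tf; rewrite -TG; apply/arrow_graphP; exists f.
    have ij := Girr _ _ Gij; have [Gji|Gji] /= := boolP ((j, i) \in G); last first.
      rewrite Tanti //; apply: contra Gji => Tf; rewrite -TG.
      by apply/arrow_graphP; exists (f^-1)%g.
    case: ltnP => lt_ij; rewrite ffunE inE /=; first by rewrite lt_ij Gij Gji inE.
    by rewrite Gij Gji ltn_neqAle eq_sym ij lt_ij /= inE Tanti.
  case=> phi /RP Hphi ->{T}.
  have D i j : i < j -> (i, j) \in G -> (j, i) \in G -> (i, j) \in ordered_double_edges G.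
    by move=> ij Gij Gji; rewrite inE ij Gij.
  have TG : arrow_graph (Tof phi) = G.
    apply/setP => -[i j]; apply/arrow_graphP/idP => [[f]|Gij].
      by rewrite inE => /andP[].
    have [Gji|Gji] := boolP ((j, i) \in G); last first.
      by exists 1%g; rewrite inE /= Gij (negPf Gji).
    case: (ltngtP i j) => [ij|ji|/val_inj ij].
    - have := Hphi (i, j); rewrite D // inE => /andP[/set0Pn[f phif] _].
      by exists f; rewrite inE /= Gij Gji ij.
    - have := Hphi (j, i); rewrite D // inE => /andP[_].
      rewrite -subTset => /subsetPn[f _ phif].
      by exists (f^-1)%g; rewrite inE /= Gij Gji ltnNge ltnW //= invgK.
    - by have := Girr _ _ Gij; rewrite ij eqxx.
  split; last by rewrite TG.
  rewrite inE TG Gsc andbT; apply/antisymP; split=> [i j f|i j f ij].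
    by rewrite inE => /andP[/Girr].
  rewrite !inE /=.
  have := Gt i j ij; have [Gij|Gij] /= := boolP ((i, j) \in G); last by move=> ->.
  have [Gji|//] /= := boolP ((j, i) \in G).
  by case: (ltngtP i j) => [||/val_inj/eqP]; rewrite ?invgK ?negbK // (negPf ij).
apply/ffunP => -[i j]; have := Hphi (i, j); have := Hpsi (i, j).
case: ifP => [|_ -> ->//]; rewrite inE /= => /and3P[ij Gij Gji] _ _.
by apply/setP => f; rewrite -!TofE // E.
Qed.

End Fiber.

Lemma card_orientations :
  #|orientations| = \sum_(0 <= k < 'C(m, 2).+1) w2 m k * (2 ^ n`! - 2) ^ k.
Proof.
rewrite -sum_double_edges -sum1_card.
rewrite (partition_big arrow_graph
  (fun G => complete_digraph G && strongly_connected G)) => [|T]; last first.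
  by rewrite inE => /andP[/antisym_complete-> ->].
apply: eq_bigr => G /andP[Gc Gsc].
rewrite card_double_edges; last by case/andP: Gc.
by rewrite -card_fiber // -sum1_card; apply: eq_bigl => T; rewrite inE.
Qed.

End Families.

(** This thins a generating set to one idempotent per kernel without losing an arc. The complement
    of b serves unless b is everything; then a singleton in a serves, proper because there are two
    elements, or the empty set if a is empty. *)
Lemma exists_split (T : finType) (a b : {set T}) : 1 < #|T| -> a :|: b = setT ->
  exists A : {set T}, [/\ A \subset a, ~: A \subset b,
    a != set0 -> A != set0 & b != set0 -> A != setT].
Proof.
move=> T2 ab; have [bT|bN] := eqVneq b setT; last first.
  exists (~: b); split; last by rewrite -setC0 (inj_eq (@setC_inj T)).
  - by apply/subsetP => x; have := in_setT x; rewrite -ab !inE => /orP[->|->].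
  - by rewrite setCK.
  by rewrite -setCT (inj_eq (@setC_inj T)) bN.
have [->|/set0Pn[x ax]] := eqVneq a set0.
  exists set0; rewrite bT sub0set subsetT eqxx; split=> // _.
  by rewrite eq_sym -card_gt0 cardsT ltnW.
exists [set x]; rewrite sub1set ax bT subsetT; split=> // _.
  by apply/set0Pn; exists x; rewrite inE.
apply/eqP => /(congr1 (fun A : {set T} => #|A|)).
by rewrite cards1 cardsT => E; rewrite -E in T2.
Qed.

(** * Minimal idempotent generating sets of S *)

Section MinimalFamilyOfS.
Variables m n' : nat.
Local Notation n := n'.+2.
Local Notation X := ('I_m * 'I_n)%type.
Local Notation S := (gen_monoid (idempotents (T_part m n))).
Local Notation arrow := ('I_m * 'I_m * 'S_n)%type.
Implicit Types (T : {set arrow}) (f : 'S_n) (g : transf 'I_n).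
Implicit Types (i j : 'I_m) (U : {set transf X}).
Implicit Type Us : {ffun 'I_m -> {set transf 'I_n}}.

Definition shifts T : {set transf X} := [set e_wr t.1.1 t.1.2 t.2 | t in T].

Definition assemble Us T : {set transf X} :=
  (\bigcup_(i < m) [set at_pos i g | g in Us i]) :|: shifts T.

Definition min_families : {set {ffun 'I_m -> {set transf 'I_n}} * {set arrow}} :=
  setX [set Us | Us \in ffun_on (min_gen_sets n)] (orientations m n').

Definition min_gen_sets_S : {set {set transf X}} :=
  [set assemble x.1 x.2 | x in min_families].

Lemma min_familiesP Us T : reflect
  [/\ forall i, Us i \in min_gen_sets n, antisym T & strongly_connected (arrow_graph T)]
  ((Us, T) \in min_families).
Proof.
rewrite in_setX !in_set; apply: (iffP and3P) => -[UsE aT scT]; split=> //.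
  exact/ffun_onP.
exact/ffun_onP.
Qed.

Section Assemble.
Variables (Us : {ffun 'I_m -> {set transf 'I_n}}) (T : {set arrow}).
Hypothesis UsT : (Us, T) \in min_families.

Let Us_min i : Us i \in min_gen_sets n.
Proof. by have [] := min_familiesP _ _ UsT. Qed.

Let T_antisym : antisym T.
Proof. by have [] := min_familiesP _ _ UsT. Qed.

Let T_sc : strongly_connected (arrow_graph T).
Proof. by have [] := min_familiesP _ _ UsT. Qed.

Let T_irr i j f : (i, j, f) \in T -> i != j.
Proof. by have [H _] := antisymP _ T_antisym; apply: H. Qed.

Let T_anti i j f : i != j -> ((i, j, f) \in T) = ((j, i, f^-1%g) \notin T).
Proof. by have [_ H] := antisymP _ T_antisym; apply: H. Qed.

Let Us_neq1 i g : g \in Us i -> g != 1%g.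
Proof. exact: min_gen_sets_neq1. Qed.

Lemma mem_shifts i j f : i != j -> (e_wr i j f \in shifts T) = ((i, j, f) \in T).
Proof.
move=> ij; apply/imsetP/idP => [[[[i' j'] f'] T' /=]|Tf]; last by exists (i, j, f).
by case/(e_wr_inj ij) => -> -> ->.
Qed.

Lemma shifts_tbar p : p \in shifts T -> tbar p != 1%g.
Proof.
case/imsetP=> -[[i j] f] /T_irr ij ->; rewrite tbar_wr; exact: e_map_neq1.
Qed.

(** Since 1 lies in no U_j, an element g^(j) determines its block, and the elements of [shifts T]
    act nontrivially on blocks. Hence the parameters can be recovered from the set. *)
Lemma comps_assemble i : comps (assemble Us T) i = Us i.
Proof.
apply/setP => g; rewrite 2!inE; apply/orP/idP => [[/bigcupP[j _ /imsetP[h Uh E]]|]|Ug].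
- have [ij|ij] := eqVneq j i; first by move: E; rewrite ij in Uh * => /at_pos_inj->.
  have [_ /(_ j)] := wr_inj E; rewrite eqxx (negPf ij) => h1.
  by have := Us_neq1 Uh; rewrite -h1 eqxx.
- by move/shifts_tbar; rewrite tbar_wr eqxx.
- by left; apply/bigcupP; exists i => //; apply: imset_f.
Qed.

Lemma e_wr_assemble i j f :
  i != j -> (e_wr i j f \in assemble Us T) = ((i, j, f) \in T).
Proof.
move=> ij; rewrite in_setU mem_shifts //; case: bigcupP => // -[k _ /imsetP[h _]].
by case/wr_inj => /eqP; rewrite (negPf (e_map_neq1 ij)).
Qed.

Lemma arcs_assemble : arcs (assemble Us T) = arrow_graph T.
Proof.
apply/setP => -[i j]; rewrite !inE /=; have [<-|ij] := eqVneq i j.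
  by apply/esym/negbTE/existsPn => f; apply: contraTN isT => /T_irr; rewrite eqxx.
by apply: eq_existsb => f; rewrite e_wr_assemble.
Qed.

Lemma assemble_gen : idem_gen_set S (assemble Us T).
Proof.
have Uidem : assemble Us T \subset idempotents S.
  apply/subsetP => p; rewrite in_setU => /orP[/bigcupP[i _ /imsetP[g Ug ->]]|].
    have /andP[/subsetP/(_ g Ug) gE _] := min_gen_sets_gen (Us_min i).
    move: gE; rewrite !inE => /andP[gE /eqP gg].
    by rewrite at_pos_S // -at_posM gg /=.
  case/imsetP=> -[[i j] f] /T_irr ij -> /=.
  by rewrite inE e_wr_S // e_wr_idem /=.
apply/andP; split=> //; apply/eqP; apply: gen_monoid_S Uidem _.
- move=> i j f ij; rewrite !e_wr_assemble // 1?eq_sym //.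
  by rewrite T_anti // orNb.
- by rewrite arcs_assemble.
move=> i; rewrite comps_assemble.
by have /andP[_ /eqP] := min_gen_sets_gen (Us_min i).
Qed.

Lemma card_assemble : #|assemble Us T| = (\sum_(i < m) #|Us i| + #|T|)%N.
Proof.
rewrite cardsU (_ : _ :&: _ = set0) ?cards0 ?subn0; last first.
  apply/setP => p; rewrite in_setI inE; apply/negP.
  case/andP=> /bigcupP[i _ /imsetP[g _ ->]] /shifts_tbar.
  by rewrite tbar_wr eqxx.
congr (_ + _)%N; last first.
  apply: card_in_imset => -[[i j] f] [[i' j'] f'] /T_irr ij _ /=.
  by case/(e_wr_inj ij) => -> -> ->.
rewrite (_ : \bigcup_(i < m) _ = [set at_pos x.1 x.2 |
    x in [set x : 'I_m * transf 'I_n | x.2 \in Us x.1]]); last first.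
  apply/setP => p; apply/bigcupP/imsetP => [[i _ /imsetP[g Ug ->]]|[[i g]]].
    by exists (i, g); rewrite ?inE.
  by rewrite inE /= => Ug ->; exists i => //; apply: imset_f.
rewrite card_in_imset => [|[i g] [i' g']]; last first.
  rewrite !inE /= => Ug Ug' E; have [ii|ii] := eqVneq i i'.
    by move: E; rewrite ii => /at_pos_inj->.
  have [_ /(_ i)] := wr_inj E; rewrite eqxx (negPf ii) => g1.
  by have := Us_neq1 Ug; rewrite g1 eqxx.
rewrite -sum1dep_card; under [RHS]eq_bigr do rewrite -sum1_card.
by rewrite pair_big_dep.
Qed.

End Assemble.

Lemma min_gen_sets_S_gen U : U \in min_gen_sets_S -> idem_gen_set S U.
Proof. by case/imsetP=> -[Us T] UsT ->; apply: assemble_gen. Qed.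

Lemma min_gen_sets_S_card U U' :
  U \in min_gen_sets_S -> U' \in min_gen_sets_S -> #|U| = #|U'|.
Proof.
case/imsetP=> -[Us T] UsT -> /imsetP[[Us' T'] UsT' ->] /=.
rewrite !card_assemble //; congr (_ + _)%N.
  have [[H _ _] [H' _ _]] := (min_familiesP _ _ UsT, min_familiesP _ _ UsT').
  by apply: eq_bigr => i _; apply: min_gen_sets_card (H i) (H' i).
have [[_ aT _] [_ aT' _]] := (min_familiesP _ _ UsT, min_familiesP _ _ UsT').
by apply: double_inj; rewrite !card_antisym.
Qed.

(** A minimal generating set is chosen inside each [comps U i], and [exists_split] selects one
    idempotent of [U] for each kernel. *)
Lemma min_gen_sets_S_sub U : idem_gen_set S U ->
  exists2 U', U' \in min_gen_sets_S & U' \subset U.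
Proof.
case/andP=> UE /eqP Ugen.
have /fin_all_exists[us us_min] i :
    exists V, V \in min_gen_sets n /\ V \subset comps U i.
  have [|V] := @min_gen_sets_sub n isT (comps U i); last by exists V.
  apply/andP; split; last by rewrite (gen_comps UE Ugen).
  apply/subsetP => g Ug; have Ug' : at_pos i g \in U by rewrite inE in Ug.
  have [_] := mem_U UE Ug'; rewrite -at_posM => /at_pos_inj gg.
  by rewrite inE -(gen_comps UE Ugen i) mem_gen_monoid //= gg.
have Ucov := gen_covers UE Ugen.
pose a (q : 'I_m * 'I_m) := [set f | e_wr q.1 q.2 f \in U].
pose b (q : 'I_m * 'I_m) := [set f | e_wr q.2 q.1 f^-1%g \in U].
have /fin_all_exists[A AP] (q : 'I_m * 'I_m) : exists A : {set 'S_n}, q.1 != q.2 ->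
    [/\ A \subset a q, ~: A \subset b q, a q != set0 -> A != set0
      & b q != set0 -> A != setT].
  case: (boolP (q.1 == q.2)) => [_|q12]; first by exists set0.
  have [||A HA] := @exists_split _ (a q) (b q); last by exists A.
    by rewrite card_Sn factS (leq_trans _ (leq_pmulr _ (fact_gt0 _))).
  by apply/setP => f; rewrite !inE; apply: Ucov.
(* For i < j, [A (i, j)] labels the direction (i, j), and the inverses of its complement label (j,
   i). *)
pose T : {set arrow} := [set t : arrow | (t.1.1 != t.1.2) &&
   (if t.1.1 < t.1.2 then t.2 \in A t.1 else t.2^-1%g \notin A (t.1.2, t.1.1))].
have T_anti : antisym T.
  apply/antisymP; split=> [i j f|i j f ij]; first by rewrite inE => /andP[].
  rewrite !inE /= ij [j == i]eq_sym ij /=.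
  by case: (ltngtP i j) => [||/val_inj/eqP]; rewrite ?invgK ?negbK // (negPf ij).
have T_sub : shifts T \subset U.
  apply/subsetP => _ /imsetP[[[i j] f] + ->]; rewrite inE /= => /andP[ij].
  case: ifP => _.
    by have [/subsetP sub _ _ _] := AP (i, j) ij; move/sub; rewrite inE.
  have [|_ /subsetP sub _ _] := AP (j, i); first by rewrite /= eq_sym.
  by rewrite -in_setC => /sub; rewrite inE /= invgK.
(* A direction present in [U] keeps at least one label, so strong connectivity is inherited. *)
have T_supp : arrow_graph T = arcs U.
  apply/setP => -[i j]; apply/arrow_graphP/idP => [[f Tf]|].
    rewrite inE /=; move: (Tf); rewrite inE /= => /andP[-> _] /=.
    by apply/existsP; exists f; apply: (subsetP T_sub); apply/imsetP; exists (i, j, f).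
  rewrite inE /= => /andP[ij /existsP[f Uf]].
  case: (ltngtP i j) => [lt_ij|lt_ji|/val_inj/eqP]; last by rewrite (negPf ij).
    have [_ _ HA _] := AP (i, j) ij.
    have /HA/set0Pn[h Ah] : a (i, j) != set0 by apply/set0Pn; exists f; rewrite inE.
    by exists h; rewrite inE /= ij lt_ij.
  have [|_ _ _ HA] := AP (j, i); first by rewrite /= eq_sym.
  have : b (j, i) != set0 by apply/set0Pn; exists f^-1%g; rewrite inE /= invgK.
  move/HA; rewrite -subTset => /subsetPn[h _ Ah].
  by exists h^-1%g; rewrite inE /= ij ltnNge ltnW //= invgK.
pose Us := [ffun i => us i].
have UsT : (Us, T) \in min_families.
  apply/min_familiesP; rewrite T_supp; split=> //.
    by move=> i; rewrite ffunE; have [] := us_min i.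
  exact: gen_strongly_connected UE Ugen.
exists (assemble Us T); first by apply/imsetP; exists (Us, T).
rewrite subUset T_sub andbT; apply/bigcupsP => i _.
apply/subsetP => _ /imsetP[g + ->]; rewrite ffunE.
by have [_ /subsetP sub] := us_min i; move/sub; rewrite inE.
Qed.

Lemma min_idem_gen_set_S U : min_idem_gen_set S U = (U \in min_gen_sets_S).
Proof.
exact: (min_idem_gen_setE min_gen_sets_S_gen min_gen_sets_S_sub min_gen_sets_S_card).
Qed.

Lemma card_min_gen_sets_S : #|min_gen_sets_S|
  = (sigma n ^ m * \sum_(0 <= k < 'C(m, 2).+1) w2 m k * (2 ^ n`! - 2) ^ k)%N.
Proof.
rewrite card_in_imset => [|[Us T] [Us' T'] UsT UsT' /= E].
  rewrite cardsX card_orientations cardsE card_ffun_on card_ord.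
  by rewrite card_min_gen_sets.
congr (_, _).
  by apply/ffunP => i; rewrite -(comps_assemble UsT) E comps_assemble.
apply/setP => -[[i j] f].
have irr T0 Us0 : (Us0, T0) \in min_families -> (i, j, f) \in T0 -> i != j.
  by case/min_familiesP=> _ /antisymP[H _] _; apply: H.
have [ij|ij] := eqVneq i j.
  apply/idP/idP => [/(irr _ _ UsT)|/(irr _ _ UsT')]; by rewrite ij eqxx.
by rewrite -(e_wr_assemble Us) // E e_wr_assemble.
Qed.

(** Single edges of the graph give the part over [Phi] and double edges the part over [Xi]. The set
    B_{ij} holds the inverses of the labels selected on (j, i), complementary to A_{ij}. *)
Lemma shifts_W_set T : antisym T ->
  shifts T = W_set (edge_maps (arrow_graph T))
    (fun i j => [set f | (i, j, f) \in T]) (fun i j => [set f | (j, i, f^-1%g) \in T]).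
Proof.
move=> aT; have [Tirr Tanti] := antisymP _ aT.
have Vij i j : i != j ->
    (e_map i j \in edge_maps (arrow_graph T)) = ((i, j) \in arrow_graph T).
  move=> ij; have /complete_loopless Gl := antisym_complete aT.
  by rewrite -[in RHS](dig_edge_maps Gl) in_dig ij.
apply/setP => p; rewrite /W_set in_setU; apply/imsetP/orP.
  case=> -[[i j] f] Tf ->; have ij := Tirr _ _ _ Tf.
  have ji : j != i by rewrite eq_sym.
  have Gij : (i, j) \in arrow_graph T by apply/arrow_graphP; exists f.
  have [Gji|Gji] := boolP ((j, i) \in arrow_graph T); last first.
    left; apply/bigcupP; exists (i, j); last by apply: imset_f.
    by rewrite inE /= ij !Vij // Gij.
  right; case: (ltngtP i j) => [lt_ij|lt_ji|/val_inj/eqP]; last by rewrite (negPf ij).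
    apply/bigcupP; exists (i, j); first by rewrite inE /= lt_ij !Vij // Gij.
    by rewrite in_setU imset_f // inE.
  apply/bigcupP; exists (j, i); first by rewrite inE /= lt_ji !Vij // Gij Gji.
  rewrite in_setU; apply/orP; right; apply/imsetP; exists f^-1%g; rewrite ?invgK //.
  by rewrite inE /= invgK.
case=> /bigcupP[[i j]].
  rewrite inE /= => /and3P[ij]; have ji : j != i by rewrite eq_sym.
  rewrite !Vij // => Gij Gji /imsetP[f _ ->]; exists (i, j, f) => //.
  (* If the reverse edge is absent, every label f must be selected on (i, j). *)
  by rewrite Tanti //; apply: contra Gji => Tf; apply/arrow_graphP; exists f^-1%g.
rewrite inE /= => _; rewrite in_setU => /orP[] /imsetP[f]; rewrite inE => Tf ->.
  by exists (i, j, f).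
by exists (j, i, f^-1%g).
Qed.

End MinimalFamilyOfS.

(** * The three assertions, read off from the family of minimal sets *)

Lemma emaps_defect1 k : emaps k \subset idempotents (defect1 k).
Proof.
apply/subsetP => _ /emapsP[i [j [ij ->]]]; rewrite 2!inE e_map_idem eqxx andbT.
rewrite (_ : [set _ | _ : _] = [set~ j]) ?cardsC1 ?card_ord //.
apply/setP => x; rewrite !inE; apply/imsetP/idP => [[y _ ->]|xj].
  by rewrite e_mapE; case: (y =P j) => // /eqP.
by exists x => //; rewrite e_mapE (negPf xj).
Qed.

Theorem theorem4p11 (m n : nat) (hm : 2 <= m) (hn : 2 <= n) :
  let S : {set transf ('I_m * 'I_n)%type} :=
    gen_monoid (idempotents (T_part m n)) in
  [/\ (forall U : {set transf ('I_m * 'I_n)%type}, idem_gen_set S U ->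
         exists2 U' : {set transf ('I_m * 'I_n)%type},
           U' \subset U & min_idem_gen_set S U'),
      (forall U : {set transf ('I_m * 'I_n)%type}, min_idem_gen_set S U ->
         exists (Us : 'I_m -> {set transf 'I_n}) (V : {set transf 'I_m})
                (A B : 'I_m -> 'I_m -> {set 'S_n}),
           [/\ forall i, min_idem_gen_set (idem_gen_part n) (Us i),
               V \subset idempotents (defect1 m),
               [set: transf 'I_m] :\: sym_group m = gen_semigroup V,
               forall i j, (i, j) \in Xi V ->
                 [/\ A i j != set0, B i j != set0,
                     [set: 'S_n] = A i j :|: B i j
                   & [disjoint A i j & B i j]]
             & U = (\bigcup_(i < m) [set at_pos i g | g in Us i])
                   :|: W_set V A B])
    & #|[set U : {set transf ('I_m * 'I_n)%type} | min_idem_gen_set S U]|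
      = sigma n ^ m
        * \sum_(0 <= k < 'C(m, 2).+1) w2 m k * (2 ^ n`! - 2) ^ k].
Proof.
case: n hn => [|[|n']] // hn S; split.
- move=> U /min_gen_sets_S_sub[U' mU' U'U]; exists U' => //.
  by rewrite min_idem_gen_set_S.
- move=> U; rewrite min_idem_gen_set_S => /imsetP[[Us T] UsT ->] /=.
  have [Us_min aT scT] := min_familiesP _ _ UsT.
  have [Tirr Tanti] := antisymP _ aT.
  have cT := antisym_complete aT; have lT := complete_loopless cT.
  exists Us, (edge_maps (arrow_graph T)), (fun i j => [set f | (i, j, f) \in T]),
    (fun i j => [set f | (j, i, f^-1%g) \in T]); split.
  + by move=> i; rewrite min_idem_gen_set_part //; apply: Us_min.
  + exact: subset_trans (edge_maps_sub lT) (emaps_defect1 m).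
  + by rewrite gen_semigroup_dig ?dig_edge_maps // edge_maps_sub.
  + move=> i j; rewrite inE /= => /and3P[lt_ij].
    have ij : i != j by apply: contraTneq lt_ij => ->; rewrite ltnn.
    case/imsetP=> -[i1 j1] Tij /(e_map_inj ij)[/= Ei Ej].
    have ji : j != i by rewrite eq_sym.
    case/imsetP=> -[i2 j2] Tji /(e_map_inj ji)[/= Ej' Ei'].
    subst i1 j1 i2 j2; have [f Tf] := arrow_graphP _ _ _ Tij.
    have [h Th] := arrow_graphP _ _ _ Tji.
    split.
    * by apply/set0Pn; exists f; rewrite inE.
    * by apply/set0Pn; exists h^-1%g; rewrite inE invgK.
    * by apply/setP => e; rewrite !inE Tanti // orNb.
    * by rewrite disjoint_subset; apply/subsetP => e; rewrite !inE Tanti.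
  + by rewrite /assemble (shifts_W_set aT).
- rewrite -card_min_gen_sets_S; congr #|pred_of_set _|; apply/setP => U.
  by rewrite inE min_idem_gen_set_S.
Qed.
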